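(* Let $C$ be a nonempty convex weakly compact subset of a Banach space $X$ without the Schur property. Suppose there exists $\varepsilon\in(0,1)$ such that for every $x$ in the unit sphere $S_X$, $b_1(1,x)<1-\varepsilon$ or $d(1,x)>\varepsilon$. Then every continuous mapping $T:C\to C$ which satisfies condition $(C_\lambda)$ for some $\lambda\in(0,1)$ has a fixed point. Moreover, the assumption of continuity of $T$ can be dropped if $T$ satisfies condition $(C)$; that is, every mapping $T:C\to C$ satisfying condition $(C)$ has a fixed point.
   Context: For $\lambda\in(0,1)$, a mapping $T:C\to X$ satisfies condition $(C_\lambda)$ if for all $x,y\in C$: $\lambda\|x-Tx\|\le\|x-y\|$ implies $\|Tx-Ty\|\le\|x-y\|$. Condition $(C)$ is condition $(C_{1/2})$. $B_X$ and $S_X$ denote the closed unit ball and unit sphere of $X$. A Banach space has the Schur property if every weakly convergent sequence in it converges in norm. For a Banach space $X$ without the Schur property, $x\in X$ and $\varepsilon\ge 0$, define $$d(\varepsilon,x)=\inf\Big\{\limsup_{n\to\infty}\|x+\varepsilon y_n\|-\|x\| : (y_n)\text{ is a weakly null sequence in }S_X\Big\},$$ $$b_1(\varepsilon,x)=\sup_{(y_n)\in\mathcal{M}_X}\liminf_{n\to\infty}\|x+\varepsilon y_n\|-\|x\|,$$ where $\mathcal{M}_X$ is the set of all weakly null sequences $(y_n)$ in $B_X$ such that $\limsup_{n\to\infty}\limsup_{m\to\infty}\|y_n-y_m\|\le 1$. *)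

(* Defs.v *)
From HB Require Import structures.
From mathcomp Require Import all_boot all_order all_algebra.
From mathcomp Require Import all_classical all_reals all_analysis.

Set Implicit Arguments.
Unset Strict Implicit.
Unset Printing Implicit Defensive.

Import Order.TTheory GRing.Theory Num.Theory.
Import numFieldNormedType.Exports.

Local Open Scope classical_set_scope.
Local Open Scope ring_scope.

Definition continuous_dual (R : realType) (X : normedModType R) : Type :=
  {f : {linear X -> R^o} | continuous f}.

(* The carrier X with its weak topology sigma(X, X^* ): the coarsest topology
   making every continuous linear functional continuous. *)
Definition weak_space (R : realType) (X : normedModType R) : topologicalType :=
  sup_topology (fun f : continuous_dual X =>
    Topological.class (initial_topology (sval f : X -> R^o))).

Definition weak_cvg (R : realType) (X : normedModType R)
    (y : nat -> X) (x : X) : Prop :=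
  y @ \oo --> (x : weak_space X).

Definition weakly_null (R : realType) (X : normedModType R)
    (y : nat -> X) : Prop :=
  weak_cvg y 0.

Definition weakly_compact (R : realType) (X : normedModType R)
    (C : set X) : Prop :=
  compact (C : set (weak_space X)).

Definition Schur_property (R : realType) (X : normedModType R) : Prop :=
  forall (y : nat -> X) (x : X), weak_cvg y x -> cvg (y @ \oo).

Definition unit_ball (R : realType) (X : normedModType R) : set X :=
  [set x | `|x| <= 1].
Arguments unit_ball {R} X _.

Definition unit_sphere (R : realType) (X : normedModType R) : set X :=
  [set x | `|x| = 1].
Arguments unit_sphere {R} X _.

(* The infimum and supremum defining d and b_1 are taken in the extended reals.
   The infimum ranges over a nonempty set when X fails the Schur property;
   for a space with the Schur property it would be +oo. *)
Definition d_coef (R : realType) (X : normedModType R)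
    (eps : R) (x : X) : \bar R :=
  ereal_inf [set (limn_esup (fun n => `|x + eps *: y n|%:E) - `|x|%:E)%E
    | y in [set y : nat -> X |
        weakly_null y /\ forall n, unit_sphere X (y n)]].

Definition M_family (R : realType) (X : normedModType R) : set (nat -> X) :=
  [set y | [/\ weakly_null y,
               forall n, unit_ball X (y n) &
               (limn_esup (fun n => limn_esup (fun m => `|y n - y m|%:E))
                  <= 1%:E)%E]].
Arguments M_family {R} X _.

Definition b1_coef (R : realType) (X : normedModType R)
    (eps : R) (x : X) : \bar R :=
  ereal_sup [set (limn_einf (fun n => `|x + eps *: y n|%:E) - `|x|%:E)%E
    | y in M_family X].

(* A mapping T : C -> X is represented by a total function on X of which only
   the values on C are constrained. *)
Definition condition_C_lambda (R : realType) (X : normedModType R)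
    (lambda : R) (C : set X) (T : X -> X) : Prop :=
  forall x y, C x -> C y ->
    lambda * `|x - T x| <= `|x - y| -> `|T x - T y| <= `|x - y|.

Definition condition_C (R : realType) (X : normedModType R)
    (C : set X) (T : X -> X) : Prop :=
  condition_C_lambda 2^-1 C T.

(* Main.v *)
From HB Require Import structures.
Require Import Defs.
From mathcomp Require Import all_boot all_order all_algebra.
From mathcomp Require Import all_classical all_reals all_analysis.
From mathcomp Require Import ring lra.
Import Order.TTheory GRing.Theory Num.Theory.
Import numFieldNormedType.Exports.
Local Open Scope classical_set_scope.
Local Open Scope ring_scope.

(** Suppose that [T] has no fixed point in [C].  Zorn's lemma and weak
    compactness give a minimal nonempty convex weakly closed invariant set [K]
    ([exists_minimal_invariant]).  Iterating a weighted average of the identity and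
    [T] yields points of [K] that are moved as little as one wishes, after a number
    of steps that does not depend on the starting point
    ([averaged_residual_small]).  Condition (C), or continuity together with
    (C_lambda), ensures that a point that is hardly moved cannot see [T x] from
    much farther away than it sees [x]; hence the asymptotic balls of an
    approximate fixed point sequence are invariant, and by minimality they are
    empty or equal to [K].  If [rho] is the least possible asymptotic radius, it
    follows that there is an approximate fixed point sequence [x_n] with
    [|x_n - b|] tending to [rho] for every [b] in [K], and that no point that is
    hardly moved is much closer than [rho] to a given [b]
    ([goebel_karlovitz]).  Pass to a subsequence converging weakly to a point
    [p], and scale so that [p = 0] and [rho = 1].

    Now start the averaged iteration at the points [4/5 x_n] and stop it after
    a fixed number of steps, so many that the resulting points [z_n] are hardly
    moved.  For such iterates (C_lambda) behaves like nonexpansiveness with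
    respect to the [x_n] and among the [z_n], so that the relations
    [|z_n - x_n| <= 1/5] and [|z_n - z_m| <= 4/5] of the starting points persist
    up to a small error ([interpolating_iterates]), while [|z_n|] is at least
    almost [1] because [z_n] is hardly moved.  Let [v] be the weak limit of a
    subsequence.  Then [|v| <= 1/5] and [|z_n - v| <= 4/5], and since the sum
    has norm almost [1], both are almost equalities.  Put [u = v / |v|].
    The sequence [5/4 (z_n - v)] belongs to the family defining [b_1], and
    [|u + 5/4 (z_n - v)|] is almost [2], so [b_1(1, u)] is almost at least [1].
    The weakly null sequence [w_n = z_n - v - x_n] has norms at least about
    [1 - 4/5 = 1/5], and [|v + w_n| = |z_n - x_n|] is at most about [1/5], so the
    normalized [w_n] show that [d(1, u)] is almost at most [0]
    ([crease_direction]).  This contradicts the assumption on the unit sphere.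

    The functional analysis needed on the way is the Hahn-Banach theorem, in
    the form of Mazur and Orlicz ([mazur_orlicz]), the fact that the weak and
    the norm closure of a convex set agree ([weak_closure_convex]), the
    extraction of weakly convergent subsequences in weakly compact sets
    ([eberlein_smulian]), and the boundedness of weakly compact convex sets
    ([weakly_compact_bounded]). *)

Set Implicit Arguments.
Unset Strict Implicit.
Unset Printing Implicit Defensive.

(** * Sublinear functionals and the Hahn-Banach theorem *)

(** Homogeneity is only required as an inequality, which passes directly to
    infima; applied to [t] and to its inverse it gives equality. *)
Definition sublinear (R : realType) (V : lmodType R) (q : V -> R) : Prop :=
  (forall x y, q (x + y) <= q x + q y) /\
  (forall t x, 0 < t -> q (t *: x) <= t * q x).

Lemma sublinear0 (R : realType) (V : lmodType R) (q : V -> R) :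
  sublinear q -> q 0 = 0.
Proof.
move=> [qD qZ]; have := qD 0 0; rewrite addr0 => h1.
have := qZ 2^-1 0; rewrite scaler0 => h2; have {}h2 : q 0 <= 2^-1 * q 0.
  by apply: h2; lra.
lra.
Qed.

Lemma sublinear_opp (R : realType) (V : lmodType R) (q : V -> R) x :
  sublinear q -> - q (- x) <= q x.
Proof.
move=> sq; have := sq.1 x (- x); rewrite subrr sublinear0 //; lra.
Qed.

(** The functional is [x |-> inf (q (x + k) - c)] over the pairs [(k, c)] of the
    cone [G]; it is finite because [q (x + k) - c >= - q (- x)].  A linear
    minorant [f] of it is a linear minorant of [q] with [c <= f k] on [G].  Taking
    for [G] a ray shows that a sublinear functional which cannot be lowered is
    odd. *)
Lemma sublinear_cone (R : realType) (V : lmodType R) (q : V -> R)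
    (G : V -> R -> Prop) :
  sublinear q -> G 0 0 ->
  (forall k c k' c', G k c -> G k' c' -> G (k + k') (c + c')) ->
  (forall t k c, 0 < t -> G k c -> G (t *: k) (t * c)) ->
  (forall k c, G k c -> c <= q k) ->
  exists q' : V -> R, [/\ sublinear q', forall x, q' x <= q x &
    forall k c, G k c -> q' (- k) <= - c].
Proof.
move=> sq G0 GD GZ Gq; have [qD qZ] := sq.
pose S v := [set r | exists k c, G k c /\ r = q (v + k) - c].
have Slb v : lbound (S v) (- q (- v)).
  move=> _ [k [c [Gkc ->]]]; have := qD (v + k) (- v).
  by rewrite addrAC subrr add0r => h; have := Gq _ _ Gkc; lra.
have Sinf v : has_inf (S v).
  split; first by exists (q (v + 0) - 0), 0, 0.
  by exists (- q (- v)).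
have infle v k c : G k c -> inf (S v) <= q (v + k) - c.
  by move=> Gkc; apply: ge_inf; [case: (Sinf v)|exists k, c].
exists (fun v => inf (S v)); split.
- split=> [x y|t x t0].
    apply/ler_addgt0Pr => e e0; have e20 : 0 < e / 2 by lra.
    have [_ [k [c [Gk ->]]] hk] := inf_adherent e20 (Sinf x).
    have [_ [l [d [Gl ->]]] hl] := inf_adherent e20 (Sinf y).
    have := infle (x + y) _ _ (GD _ _ _ _ Gk Gl).
    by have := qD (x + k) (y + l); rewrite addrACA; lra.
  rewrite -ler_pdivrMl //; apply: lb_le_inf; first by case: (Sinf x).
  move=> _ [k [c [Gk ->]]]; rewrite ler_pdivrMl // mulrBr.
  apply: le_trans (infle _ _ _ (GZ _ _ _ t0 Gk)) _.
  by rewrite -scalerDr lerB // qZ.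
- by move=> x; have := infle x _ _ G0; rewrite addr0 subr0.
- by move=> k c Gk; have := infle (- k) _ _ Gk; rewrite addNr sublinear0 // sub0r.
Qed.

(** An odd sublinear functional is superadditive as well:
    [q x = q (x + y - y) <= q (x + y) - q y]. *)
Lemma sublinear_linear (R : realType) (V : lmodType R) (q : V -> R) :
  sublinear q -> (forall y, q (- y) <= - q y) ->
  forall a x y, q (a *: x + y) = a * q x + q y.
Proof.
move=> sq qN; have [qD qZ] := sq.
have N x : q (- x) = - q x.
  apply/eqP; rewrite eq_le qN /=; have := sublinear_opp x sq; lra.
have D x y : q (x + y) = q x + q y.
  apply/eqP; rewrite eq_le qD /=; have := qD (x + y) (- y).
  by rewrite addrK N; lra.
have Zp t x : 0 < t -> q (t *: x) = t * q x.
  move=> t0; apply/eqP; rewrite eq_le qZ //=; have ti : 0 < t^-1 by rewrite invr_gt0.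
  have := qZ _ (t *: x) ti; rewrite scalerA mulVf ?gt_eqF // scale1r => h.
  by rewrite -ler_pdivlMl.
move=> a x y; rewrite D; congr (_ + _).
have [a0|a0|->] := ltgtP a 0; last by rewrite scale0r mul0r sublinear0.
- by have := Zp (- a) x; rewrite oppr_gt0 scaleNr N mulNr => /(_ a0) /oppr_inj.
- exact: Zp.
Qed.

(** Zorn's lemma applies because all sublinear minorants of [p] are at least
    [- p (- x)] at [x], and the infimum of a chain of sublinear functionals is
    sublinear. *)
Lemma minimal_sublinear (R : realType) (V : lmodType R) (p : V -> R) :
  sublinear p -> exists q : V -> R, [/\ sublinear q, forall x, q x <= p x &
    forall q', sublinear q' -> (forall x, q' x <= q x) -> q' = q].
Proof.
move=> sp; pose below q := sublinear q /\ forall x, q x <= p x; pose T := {q | below q}.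
pose Rl (q r : T) := `[< forall x, sval r x <= sval q x >].
have [|||A Atot|[q [sq qp]] qmin] := @Zorn T Rl.
- by move=> t; apply/asboolP.
- move=> r s t /asboolP rs /asboolP st; apply/asboolP => x.
  exact: le_trans (st x) (rs x).
- move=> [s ps] [t pt] /asboolP st /asboolP ts; apply: eq_exist => /=.
  by apply/funext => x; apply/le_anti/andP; split; [exact: ts|exact: st].
- have [[a Aa]|nA] := pselect (exists a, A a); last first.
    by exists (exist below p (conj sp (fun=> lexx _))) => s As; case: nA; exists s.
  pose S v := [set sval q v | q in A].
  have Sinf v : has_inf (S v).
    split; first by exists (sval a v), a.
    exists (- p (- v)) => _ [[q [sq qp]] _ <-] /=.
    by have := sublinear_opp v sq; have := qp (- v); lra.
  have infle q v : A q -> inf (S v) <= sval q v.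
    by move=> Aq; apply: ge_inf; [case: (Sinf v)|exists q].
  suff sS : sublinear (fun v => inf (S v)) /\ forall x, inf (S x) <= p x.
    by exists (exist below _ sS) => q Aq; apply/asboolP => x /=; exact: infle.
  split; [split=> [x y|t x t0]|].
  + apply/ler_addgt0Pr => e e0; have e20 : 0 < e / 2 by lra.
    have [_ [q Aq <-] hq] := inf_adherent e20 (Sinf x).
    have [_ [r Ar <-] hr] := inf_adherent e20 (Sinf y).
    have [/asboolP qr|/asboolP rq] := Atot _ _ Aq Ar.
      have [[rD _] _] := svalP r.
      by have := qr x; have := rD x y; have := infle r (x + y) Ar; lra.
    have [[qD _] _] := svalP q.
    by have := rq y; have := qD x y; have := infle q (x + y) Aq; lra.
  + rewrite -ler_pdivrMl //; apply: lb_le_inf; first by case: (Sinf x).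
    move=> _ [q Aq <-]; rewrite ler_pdivrMl //.
    apply: le_trans (infle _ _ Aq) _; have [[_ qZ] _] := svalP q; exact: qZ.
  + move=> x; apply: le_trans (infle a x Aa) _; exact: (svalP a).2.
exists q; split=> // q' sq' q'q.
have q'p x : q' x <= p x by apply: le_trans (q'q x) (qp x).
have := qmin (exist below q' (conj sq' q'p)).
by move=> h; apply: (congr1 sval (h _)); apply/asboolP.
Qed.

(** The Hahn-Banach theorem with a prescribed lower bound on a cone.  First
    [sublinear_cone] makes the lower bound automatic for all minorants; then a
    minimal sublinear minorant is linear, since on the ray through [y] it can be
    lowered unless [q (- y) <= - q y]. *)
Theorem mazur_orlicz (R : realType) (V : lmodType R) (p : V -> R)
    (G : V -> R -> Prop) :
  sublinear p -> G 0 0 ->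
  (forall k c k' c', G k c -> G k' c' -> G (k + k') (c + c')) ->
  (forall t k c, 0 < t -> G k c -> G (t *: k) (t * c)) ->
  (forall k c, G k c -> c <= p k) ->
  exists f : V -> R, [/\ forall a x y, f (a *: x + y) = a * f x + f y,
    forall x, f x <= p x & forall k c, G k c -> c <= f k].
Proof.
move=> sp G0 GD GZ Gp.
have [p' [sp' p'p p'G]] := sublinear_cone sp G0 GD GZ Gp.
have [q [sq qp' qmin]] := minimal_sublinear sp'.
have qN y : q (- y) <= - q y.
  pose L k c := exists t : R, [/\ 0 <= t, k = t *: y & c = t * q y].
  have [|||k c [t [t0 -> ->]]|q' [sq' q'q q'L]] := @sublinear_cone _ _ _ L sq.
  - by exists 0; rewrite scale0r mul0r.
  - move=> k c k' c' [t [t0 -> ->]] [u [u0 -> ->]]; exists (t + u).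
    by rewrite addr_ge0 // scalerDl mulrDl.
  - move=> t k c t0 [u [u0 -> ->]]; exists (t * u).
    by rewrite scalerA mulrA mulr_ge0 // ltW.
  - have [/eqP ->|tn0] := boolP (t == 0); first by rewrite scale0r mul0r sublinear0.
    have tp : 0 < t by rewrite lt_neqAle eq_sym tn0.
    have ti : 0 < t^-1 by rewrite invr_gt0.
    have := sq.2 _ (t *: y) ti; rewrite scalerA mulVf // scale1r => h.
    by rewrite -ler_pdivlMl.
  - rewrite -[X in X _ <= _](qmin _ sq' q'q); apply: q'L.
    by exists 1; rewrite scale1r mul1r.
have qlin := sublinear_linear sq qN.
exists q; split=> // [x|k c Gk]; first exact: le_trans (qp' x) (p'p x).
have := qp' (- k); have := p'G _ _ Gk; have := sublinear_opp k sq; lra.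
Qed.

(** * The weak topology, its functionals and separation *)

(** The codomain is [R] itself rather than its regular module [R^o], so that
    inequalities between values are inequalities in [R]. *)
Definition pairing (R : realType) (X : normedModType R)
  (g : continuous_dual X) (x : X) : R := sval g x.

Lemma pairingD (R : realType) (X : normedModType R) (g : continuous_dual X)
  (x y : X) : pairing g (x + y) = pairing g x + pairing g y.
Proof. by rewrite /pairing linearD. Qed.

Lemma pairingZ (R : realType) (X : normedModType R) (g : continuous_dual X)
  (a : R) (x : X) : pairing g (a *: x) = a * pairing g x.
Proof. by rewrite /pairing linearZ. Qed.

Lemma pairingN (R : realType) (X : normedModType R) (g : continuous_dual X)
  (x : X) : pairing g (- x) = - pairing g x.
Proof. by rewrite /pairing linearN. Qed.

Lemma pairingB (R : realType) (X : normedModType R) (g : continuous_dual X)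
  (x y : X) : pairing g (x - y) = pairing g x - pairing g y.
Proof. by rewrite pairingD pairingN. Qed.

Lemma dual_of_contraction (R : realType) (X : normedModType R) (f : X -> R) :
  (forall a x y, f (a *: x + y) = a * f x + f y) -> (forall x, f x <= `|x|) ->
  exists g : continuous_dual X, forall x, pairing g x = f x.
Proof.
move=> flin fle.
pose h : X -> R^o := f.
have hlin : linear h by move=> a x y; exact: flin.
pose hL := GRing.isLinear.Build _ _ _ _ h hlin.
pose H : {linear X -> R^o} := HB.pack h hL.
have HN x : f (- x) = - f x.
  have := flin (-1) x 0; have f0 := flin 1 0 0.
  rewrite scale1r addr0 mul1r in f0.
  by rewrite scaleN1r addr0; lra.
have Hc : continuous H.
  apply: bounded_linear_continuous; apply/linear_boundedP.
  near=> r => x /=; rewrite (@le_trans _ _ `|x|) //.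
    by rewrite ler_norml lerNl -HN -{1}normrN !fle.
  by rewrite ler_peMl //; near: r; exact: nbhs_pinfty_ge.
by exists (exist _ H Hc).
Unshelve. all: by end_near. Qed.

Lemma convex_setP (R : realType) (V : lmodType R) (A : set V) :
  convex_set A <->
  forall x y t, A x -> A y -> 0 <= t -> t <= 1 -> A (t *: x + (1 - t) *: y).
Proof.
split=> [cA x y t Ax Ay t0 t1|cA].
  have t01 : Itv.spec (@Itv.num_sem R) (Itv.Real `[0%Z, 1%Z]) t.
    by apply/andP; split; [exact: num_real|rewrite in_itv /= t0 t1].
  have := cA x y (Itv.mk t01); rewrite !inE => /(_ Ax Ay).
  by [].
apply/convex_setW => x y; rewrite !inE => Ax Ay k k0 k1; rewrite inE.
exact: (cA x y k%:num Ax Ay (ltW k0) (ltW k1)).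
Qed.

Lemma convex_segment (R : realType) (V : lmodType R) (A : set V) (x y : V)
    (t : R) : convex_set A -> A x -> A y -> 0 <= t -> t <= 1 ->
  A (x + t *: (y - x)).
Proof.
move=> /convex_setP cA Ax Ay t0 t1.
have -> : x + t *: (y - x) = t *: y + (1 - t) *: x.
  by rewrite scalerBr scalerBl scale1r addrCA.
exact: cA.
Qed.

(** Apply [mazur_orlicz] to the norm and to the cone of the pairs
    [(t (x - a), t d)]: the cone is convex because [A] is, and it lies below the
    norm because [x] has distance at least [d] from [A].  For [A = {0}] this is
    the existence of norming functionals. *)
Lemma separation (R : realType) (X : normedModType R) (A : set X) (x : X)
    (d : R) : convex_set A -> (forall a, A a -> d <= `|x - a|) ->
  exists g : continuous_dual X, (forall v, pairing g v <= `|v|) /\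
    forall a, A a -> d <= pairing g (x - a).
Proof.
move=> /convex_setP cA dA.
pose G (k : X) (c : R) := (k = 0 /\ c = 0) \/
  exists t a, [/\ 0 < t, A a, k = t *: (x - a) & c = t * d].
have [||||k c|f [flin fle fG]] := @mazur_orlicz R X (fun v => `|v|) G.
- split=> [u v|t u t0]; first exact: ler_normD.
  by rewrite normrZ gtr0_norm.
- by left.
- move=> k c k' c' [[-> ->]|[t [a [t0 Aa -> ->]]]]; first by rewrite !add0r.
  move=> [[-> ->]|[u [b [u0 Ab -> ->]]]]; first by rewrite !addr0; right; exists t, a.
  right; exists (t + u), ((t / (t + u)) *: a + (1 - t / (t + u)) *: b).
  have tu0 : 0 < t + u by rewrite addr_gt0.
  have tune : t + u != 0 by rewrite gt_eqF.
  split => //; last by rewrite mulrDl.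
    apply: cA => //; first by rewrite divr_ge0 ?ltW.
    by rewrite ler_pdivrMr // mul1r lerDl ltW.
  rewrite !scalerBr scalerDr !scalerA mulrBr mulr1 mulrCA divff // mulr1.
  rewrite [t + u - t]addrAC subrr add0r scalerDl opprD -!addrA; congr (_ + _).
  by rewrite addrCA.
- move=> t k c t0 [[-> ->]|[u [a [u0 Aa -> ->]]]].
    by left; rewrite scaler0 mulr0.
  by right; exists (t * u), a; rewrite mulr_gt0 // scalerA mulrA.
- move=> [[-> ->]|[t [a [t0 Aa -> ->]]]]; first by rewrite normr0.
  by rewrite normrZ gtr0_norm // ler_pM2l // dA.
have [g gf] := dual_of_contraction flin fle.
exists g; split=> [v|a Aa]; rewrite gf; first exact: fle.
by apply: fG; right; exists 1, a; rewrite scale1r mul1r.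
Qed.

Lemma norming_functional (R : realType) (X : normedModType R) (x : X) :
  exists g : continuous_dual X, (forall v, pairing g v <= `|v|) /\
    pairing g x = `|x|.
Proof.
have [||g [gle g1]] := @separation R X [set 0] x `|x|.
- by apply/convex_setP => y z t -> -> _ _; rewrite !scaler0 addr0.
- by move=> a ->; rewrite subr0.
exists g; split=> //; apply/eqP; rewrite eq_le gle /=.
by have := g1 0 erefl; rewrite subr0.
Qed.

Lemma dual_weak_continuous (R : realType) (X : normedModType R)
    (g : continuous_dual X) : continuous (sval g : weak_space X -> R^o).
Proof.
move=> x; apply: (@continuous_comp (weak_space X)
  (initial_topology (sval g : X -> R^o)) R^o id (sval g)).
  exact: ((@cvg_sup X (continuous_dual X) (fun f : continuous_dual X =>
    Topological.class (initial_topology (sval f : X -> R^o)))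
    (nbhs (x : weak_space X)) x (@nbhs_filter (weak_space X) x)).1 (fun _ => id) g).
exact: initial_continuous.
Qed.

Lemma nbhs_weak (R : realType) (X : normedModType R) (g : continuous_dual X)
    (x : X) (e : R) : 0 < e ->
  nbhs (x : weak_space X) [set z | `|pairing g z - pairing g x| < e].
Proof.
move=> e0; have := @dual_weak_continuous R X g x.
move/(@cvgrPdist_lt R R^o _ _ _ _ _)/(_ e e0); apply: filterS => z.
by rewrite distrC.
Qed.

Lemma weak_cvgP (R : realType) (X : normedModType R) (y : nat -> X) (x : X) :
  weak_cvg y x <->
  forall g : continuous_dual X, (sval g (y n) : R^o) @[n --> \oo] --> sval g x.
Proof.
split=> [yx g|yx].
  exact: (cvg_comp y (sval g : weak_space X -> R^o) yx
    (@dual_weak_continuous R X g x)).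
apply/cvg_sup => g A; rewrite nbhsE => -[_ [[B Bo <-] Bx] BA].
have : nbhs (sval g x : R^o) B by exact: (@open_nbhs_nbhs R^o _ _ (conj Bo Bx)).
move=> /(yx g) h; exact: (@filterS nat \oo _ _ (y @^-1` A) (fun n => BA (y n)) h).
Qed.


Lemma weak_cvg_dist (R : realType) (X : normedModType R) (y : nat -> X) (x : X) :
  weak_cvg y x <-> forall (g : continuous_dual X) (e : R), 0 < e ->
    exists N, forall n, (N <= n)%N -> `|pairing g (y n) - pairing g x| < e.
Proof.
split=> [/weak_cvgP yx g e e0|yx].
  have /(@cvgrPdist_lt R R^o _ _ _ _ _)/(_ e e0) [N _ NP] := yx g.
  by exists N => n Nn; rewrite distrC; exact: NP.
apply/weak_cvgP => g; apply/(@cvgrPdist_lt R R^o) => e e0.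
have [N NP] := yx g e e0; exists N => // n Nn /=.
by rewrite distrC; exact: NP.
Qed.

(** * Weakly compact sets are weakly sequentially compact *)

(** Mazur's theorem: a point at positive distance from [A] would be separated
    from [A] by a functional, hence by a weak neighbourhood. *)
Lemma weak_closure_convex (R : realType) (X : normedModType R) (A : set X)
    (c : X) : convex_set A -> closure (A : set (weak_space X)) c ->
  forall e : R, 0 < e -> exists2 a, A a & `|c - a| < e.
Proof.
move=> cA clA e e0; apply: contrapT => nA.
have dA a : A a -> e <= `|c - a|.
  by move=> Aa; rewrite leNgt; apply/negP => ca; apply: nA; exists a.
have [g [_ gA]] := separation cA dA.
have [a [Aa /=]] := clA _ (nbhs_weak g c e0).
by have := gA a Aa; rewrite pairingB distrC ltr_norml; lra.
Qed.

Lemma subseq_choice (P : nat -> nat -> Prop) :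
  (forall k N, exists n, (N <= n)%N /\ P k n) ->
  exists phi : nat -> nat, {homo phi : m n / (m < n)%N} /\ forall k, P k (phi k).
Proof.
move=> H.
have [f fP] := @choice _ _ (fun (q : nat * nat) n => (q.2 <= n)%N /\ P q.1 n)
  (fun q => H q.1 q.2).
pose phi := fix phi k := if k is k'.+1 then f (k, (phi k').+1) else f (0, 0)%N.
exists phi; split.
  by apply: homo_ltn; [exact: ltn_trans|move=> k /=; have [] := fP (k.+1, (phi k).+1)].
by case=> [|k]; [have [] := fP (0, 0)%N|have [] := fP (k.+1, (phi k).+1)].
Qed.

Lemma homo_ltn_geq_id (phi : nat -> nat) : {homo phi : m n / (m < n)%N} ->
  forall n, (n <= phi n)%N.
Proof.
move=> h; elim=> // n IH; exact: leq_ltn_trans IH (h _ _ (ltnSn n)).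
Qed.

(** Compactness in the only form in which it is used for sequences. *)
Lemma weak_cluster (R : realType) (X : normedModType R) (C : set X)
    (y : nat -> X) : weakly_compact C -> (forall n, C (y n)) ->
  exists2 c, C c & forall U, nbhs (c : weak_space X) U ->
    forall N, exists n, (N <= n)%N /\ U (y n).
Proof.
move=> Cc Cy; have FF : ProperFilter (y @ \oo) by exact: fmap_proper_filter.
have [|c [Cc' cl]] := Cc (y @ \oo : set_system (weak_space X)) FF.
  by rewrite /=; exists 0%N => // n _; apply: (Cy n).
exists c => // U Uc N.
have [|z [[n Nn <-] Uz]] := cl [set y n | n in [set n | (N <= n)%N]] U _ Uc.
  by exists N => // n Nn; exists n.
by exists n.
Qed.

Lemma nbhs_weak_finite (R : realType) (X : normedModType R)
    (g_ : nat -> continuous_dual X) (x : X) (e : R) (k : nat) : 0 < e ->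
  nbhs (x : weak_space X)
    [set z | forall i, (i < k)%N -> `|pairing (g_ i) z - pairing (g_ i) x| < e].
Proof.
move=> e0; elim: k => [|k IH]; first by apply: filterS filterT.
apply: filterS (filterI IH (nbhs_weak (g_ k) x e0)) => z [h1 h2] i.
by rewrite ltnS leq_eqVlt => /predU1P[->//|]; exact: h1.
Qed.

(** Lists of pairs of a rational coefficient and an index: addition is
    concatenation, and the set of lists is countable. *)
Definition rat_comb (R : realType) (X : normedModType R) (y : nat -> X)
  (l : seq (rat * nat)) : X := \sum_(p <- l) ratr p.1 *: y p.2.

Definition rat_closed_span (R : realType) (X : normedModType R)
  (y : nat -> X) : set X :=
  [set x | forall e : R, 0 < e -> exists l, `|x - rat_comb y l| < e].

Lemma rat_closed_span_linear (R : realType) (X : normedModType R)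
    (y : nat -> X) (a : R) (u v : X) :
  rat_closed_span y u -> rat_closed_span y v -> rat_closed_span y (a *: u + v).
Proof.
move=> Su Sv e e0.
have [m hm] : exists l, `|v - rat_comb y l| < e / 3 by apply: Sv; lra.
have a1 : 0 < `|a| + 1 by have := normr_ge0 a; lra.
have [l hl] : exists l, `|u - rat_comb y l| < e / 3 / (`|a| + 1).
  by apply: Su; rewrite divr_gt0 //; lra.
pose w := rat_comb y l; have w1 : 0 < `|w| + 1 by have := normr_ge0 w; lra.
have d0 : 0 < e / 3 / (`|w| + 1) by rewrite divr_gt0 //; lra.
have [q] : exists q : rat, ratr q \in `]a - e / 3 / (`|w| + 1), a + e / 3 / (`|w| + 1)[.
  by apply: rat_in_itvoo; lra.
rewrite in_itv /= => /andP[q1 q2].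
exists ([seq (q * p.1, p.2) | p <- l] ++ m).
have -> : rat_comb y ([seq (q * p.1, p.2) | p <- l] ++ m) =
    ratr q *: w + rat_comb y m.
  rewrite /rat_comb big_cat big_map; congr (_ + _).
  by rewrite /w /rat_comb scaler_sumr; apply: eq_bigr => p _; rewrite rmorphM scalerA.
have -> : a *: u + v - (ratr q *: w + rat_comb y m) =
    a *: (u - w) + (a - ratr q) *: w + (v - rat_comb y m).
  by rewrite scalerBr scalerBl (addrA (a *: u - _)) subrK opprD addrACA.
have h1 : `|a *: (u - w)| <= e / 3.
  rewrite normrZ; have : `|u - w| * (`|a| + 1) <= e / 3.
    by rewrite -ler_pdivlMr // ltW.
  have := normr_ge0 (u - w); have := normr_ge0 a; nra.
have h2 : `|(a - ratr q) *: w| <= e / 3.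
  rewrite normrZ; have : `|a - ratr q| * (`|w| + 1) <= e / 3.
    by rewrite -ler_pdivlMr // ler_norml; lra.
  have := normr_ge0 (a - ratr q); have := normr_ge0 w; nra.
have := ler_normD (a *: (u - w) + (a - ratr q) *: w) (v - rat_comb y m).
have := ler_normD (a *: (u - w)) ((a - ratr q) *: w); lra.
Qed.

Lemma rat_closed_span_gen (R : realType) (X : normedModType R)
    (y : nat -> X) n : rat_closed_span y (y n).
Proof.
move=> e e0; exists [:: (1, n)].
by rewrite /rat_comb big_seq1 rmorph1 scale1r subrr normr0.
Qed.

Lemma rat_closed_span_convex (R : realType) (X : normedModType R)
    (y : nat -> X) : convex_set (rat_closed_span y).
Proof.
apply/convex_setP => u v t Su Sv _ _; apply: rat_closed_span_linear => //.
rewrite -[X in _ X]addr0; apply: rat_closed_span_linear => // e e0.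
by exists [::]; rewrite /rat_comb big_nil subrr normr0.
Qed.

Lemma rat_closed_span_closed (R : realType) (X : normedModType R)
    (y : nat -> X) (c : X) :
  (forall e : R, 0 < e -> exists2 a, rat_closed_span y a & `|c - a| < e) ->
  rat_closed_span y c.
Proof.
move=> H e e0; have e2 : 0 < e / 2 by lra.
have [a Sa ca] := H _ e2; have [l al] := Sa _ e2; exists l.
rewrite -[c](subrK a) -addrA; have := ler_normD (c - a) (a - rat_comb y l); lra.
Qed.

(** One norming functional for each rational combination suffices: if they all
    vanish at [w] and [D] is a combination close to [w], then [|D|] is a value at
    [D - w], hence small. *)
Lemma separating_sequence (R : realType) (X : normedModType R) (y : nat -> X) :
  exists g_ : nat -> continuous_dual X, forall w, rat_closed_span y w ->
    (forall i, pairing (g_ i) w = 0) -> w = 0.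
Proof.
pose D i := if unpickle i is Some l then rat_comb y l else 0.
have [g_ gP] := @choice _ _ (fun i (g : continuous_dual X) =>
  (forall v, pairing g v <= `|v|) /\ pairing g (D i) = `|D i|)
  (fun i => norming_functional (D i)).
exists g_ => w Sw gw; apply/normr0_eq0/eqP; rewrite eq_le normr_ge0 andbT.
apply/ler_addgt0Pr => e e0; rewrite add0r; have e2 : 0 < e / 2 by lra.
have [l wl] := Sw _ e2; have [gle gD] := gP (pickle l).
rewrite /D pickleK in gD; have := gle (rat_comb y l - w).
rewrite pairingB gw gD subr0 distrC.
have := ler_normD (w - rat_comb y l) (rat_comb y l); rewrite subrK; lra.
Qed.

(** Let [c] be a weak cluster point.  A subsequence converges to [c] along
    countably many functionals separating the points of the closed span of the
    sequence.  Were it not weakly convergent to [c], it would have another weak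
    cluster point, in the same span by [weak_closure_convex], at which these
    functionals take the same values. *)
Theorem eberlein_smulian (R : realType) (X : normedModType R) (C : set X)
    (y : nat -> X) : weakly_compact C -> (forall n, C (y n)) ->
  exists (phi : nat -> nat) (c : X), [/\ {homo phi : m n / (m < n)%N}, C c &
    weak_cvg (y \o phi) c].
Proof.
move=> Cc Cy; have [g_ gsep] := separating_sequence y.
have [c C_c cl] := weak_cluster Cc Cy.
have spanned z : (forall U, nbhs (z : weak_space X) U -> exists n, U (y n)) ->
    rat_closed_span y z.
  move=> zP; apply: rat_closed_span_closed.
  apply: weak_closure_convex; first exact: rat_closed_span_convex.
  by move=> U /zP[n Un]; exists (y n); split=> //; exact: rat_closed_span_gen.
have Sc : rat_closed_span y c by apply: spanned => U /cl /(_ 0%N) [n [_ Un]]; exists n.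
have inv0 k : 0 < k.+1%:R^-1 :> R by rewrite invr_gt0.
have [phi [phim phiP]] := @subseq_choice (fun k n => forall i, (i < k)%N ->
    `|pairing (g_ i) (y n) - pairing (g_ i) c| < k.+1%:R^-1)
  (fun k => cl _ (nbhs_weak_finite g_ c k (inv0 k))).
exists phi, c; split => //; apply/weak_cvg_dist => g e e0; apply: contrapT => nN.
have far (k N : nat) : exists n, (N <= n)%N /\
    e <= `|pairing g (y (phi n)) - pairing g c|.
  apply: contrapT => nn; apply: nN; exists N => n Nn; rewrite ltNge.
  by apply/negP => en; apply: nn; exists n.
have [psi [psim psiP]] := subseq_choice far.
have [c' C_c' cl'] := weak_cluster Cc (fun n => Cy (phi (psi n))).
have Sc' : rat_closed_span y c'.
  by apply: spanned => U /cl' /(_ 0%N) [n [_ Un]]; exists (phi (psi n)).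
have c0 : c' - c = 0.
  apply: gsep; first by rewrite addrC -scaleN1r; exact: rat_closed_span_linear.
  move=> i; apply/normr0_eq0/eqP; rewrite eq_le normr_ge0 andbT pairingB.
  apply/ler_addgt0Pr => d d0; rewrite add0r; have d2 : 0 < d / 2 by lra.
  have [M _ MP] := near_infty_natSinv_lt (PosNum d2).
  have [n [Nn /= hn]] := cl' _ (nbhs_weak (g_ i) c' d2) (maxn i.+1 M).
  move: Nn; rewrite geq_max => /andP[iN MN].
  have npsi := homo_ltn_geq_id psim n.
  have := phiP (psi n) i (leq_trans iN npsi).
  have /= := MP (psi n) (leq_trans MN npsi).
  move: hn; rewrite !ltr_norml !ler_norml; move: (psi n).+1%:R^-1 => r; lra.
have [n [_ /= hn]] := cl' _ (nbhs_weak g c' e0) 0%N.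
move/subr0_eq: c0 hn (psiP n) => -> hn; rewrite leNgt => /negP; exact.
Qed.

(** * Boundedness and weak limits *)

Lemma weakly_compact_pairing_bounded (R : realType) (X : normedModType R)
    (C : set X) (g : continuous_dual X) :
  weakly_compact C -> exists M : R, forall x, C x -> `|pairing g x| <= M.
Proof.
move=> Cc; apply: contrapT => unb.
have big (k N : nat) : exists x, C x /\ k%:R < `|pairing g x|.
  apply: contrapT => nM; apply: unb; exists k%:R => x Cx.
  by rewrite leNgt; apply/negP => Mx; apply: nM; exists x.
have [y yP] := choice (fun k => big k 0%N).
have [phi [c [phim _ /weak_cvg_dist yc]]] := eberlein_smulian Cc (fun n => (yP n).1).
have [N NP] := yc g 1 ltr01.
have [M _ MP] := nbhs_infty_ger (`|pairing g c| + 1).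
have := NP (maxn N M) (leq_maxl _ _); have := (yP (phi (maxn N M))).2.
have /= := MP _ (leq_trans (leq_maxr N M) (homo_ltn_geq_id phim _)).
have := ler_distD 0 (pairing g (y (phi (maxn N M)))) (pairing g c).
have := lerB_dist (pairing g (y (phi (maxn N M)))) (pairing g c).
by rewrite /=; lra.
Qed.

(** A gliding hump.  If [C] is unbounded, one builds points [x_n] of [C] of
    norm at least [n] such that the functional norming [x_m] is larger than
    [|x_m| - 1] at all later points: the next point is obtained by moving the
    current one slightly towards a very remote point of [C], which changes the
    finitely many functionals chosen so far only little, as they are bounded on
    [C].  At a weak cluster point [c] the functional norming [x_m] is then at
    least about [|x_m| - 1], whence [|c| >= m - 2] for all [m]. *)
Lemma weakly_compact_bounded (R : realType) (X : normedModType R) (C : set X) :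
  weakly_compact C -> convex_set C -> exists M : R, forall x, C x -> `|x| <= M.
Proof.
move=> Cc /convex_setP cC; apply: contrapT => unb.
have big (M : R) : exists2 x, C x & M < `|x|.
  apply: contrapT => nM; apply: unb; exists M => x Cx.
  by rewrite leNgt; apply/negP => Mx; apply: nM; exists x.
have [nf nfP] := choice (@norming_functional R X).
pose inv l := C (head 0 l) /\
  forall u, u \in l -> `|u| - 1 < pairing (nf u) (head 0 l).
(* How far [x] can be moved towards an arbitrary point of [C] while keeping
   the lower bounds on finitely many functionals. *)
have perturb (x : X) (l : seq X) : C x ->
    (forall u, u \in l -> `|u| - 1 < pairing (nf u) x) ->
    exists2 t : R, 0 < t <= 1 & forall w u, C w -> u \in l ->
      `|u| - 1 < pairing (nf u) (t *: w + (1 - t) *: x).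
  move=> Cx; elim: l => [|v l IH] H; first by exists 1 => //; lra.
  have [u ul|t /andP[t0 t1] tP] := IH; first by apply: H; rewrite inE ul orbT.
  have [M MP] := weakly_compact_pairing_bounded (nf v) Cc.
  have Hv := H v (mem_head _ _); set a := pairing (nf v) x in Hv.
  have M0 : 0 <= M by exact: le_trans (normr_ge0 _) (MP x Cx).
  have aM : `|a| <= M := MP x Cx.
  pose s := Num.min t ((a - (`|v| - 1)) / (2 * M + 1)).
  have s0 : 0 < s by rewrite lt_min t0 divr_gt0 //; lra.
  have st : s <= t by rewrite ge_min lexx.
  have sM : s * (2 * M + 1) <= a - (`|v| - 1).
    by rewrite -ler_pdivlMr ?ge_min ?lexx ?orbT //; lra.
  exists s; first by apply/andP; split; lra.
  move=> w u Cw; rewrite inE => /predU1P[->|ul].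
    rewrite pairingD !pairingZ -/a; have := MP w Cw.
    move: (pairing _ w) => b; move: aM; rewrite !ler_norml => /andP[? ?] /andP[? ?].
    nra.
  have Cw' : C ((s / t) *: w + (1 - s / t) *: x).
    by apply: cC => //; [rewrite divr_ge0 ?ltW|rewrite ler_pdivrMr // mul1r].
  have := tP _ u Cw' ul; congr (_ < pairing _ _).
  rewrite scalerDr !scalerA mulrBr mulr1 mulrCA divff ?gt_eqF // mulr1.
  by rewrite -addrA -scalerDl; congr (_ + _ *: _); ring.
have step (l : {l | inv l}) : exists x, inv (x :: sval l) /\ (size (sval l))%:R <= `|x|.
  case: l => l [Cx lP] /=; set x := head 0 l in Cx lP.
  have [t /andP[t0 t1] tP] := perturb x l Cx lP.
  have [w Cw wb] := big (((size l)%:R + `|x|) / t).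
  rewrite ltr_pdivrMr // in wb.
  exists (t *: w + (1 - t) *: x); split; [split=> /=|].
  - by apply: cC => //; exact: ltW.
  - move=> u; rewrite inE => /predU1P[->|ul]; last exact: tP.
    rewrite (nfP _).2; lra.
  - have := lerB_normD (t *: w) ((1 - t) *: x).
    rewrite !normrZ gtr0_norm // ger0_norm; last lra.
    have := normr_ge0 x; nra.
have [nxt nxtP] := choice step.
have [x0 Cx0 _] := big 0.
have inv0 : inv [:: x0].
  split=> // u; rewrite inE => /eqP ->; rewrite (nfP _).2 /=; lra.
(* [L n] lists [x_n, ..., x_0], the most recent point being its head. *)
pose L := fix L n : {l | inv l} := if n is m.+1
  then exist inv (nxt (L m) :: sval (L m)) (nxtP (L m)).1 else exist inv _ inv0.
pose x n := head 0 (sval (L n)).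
have sizeL n : size (sval (L n)) = n.+1 by elim: n => //= n ->.
have xL m n : (m <= n)%N -> x m \in sval (L n).
  elim: n => [|n IH]; first by rewrite leqn0 => /eqP ->; rewrite inE.
  by rewrite leq_eqVlt => /predU1P[->|/IH h]; rewrite inE ?eqxx // h orbT.
have xbig n : n.+1%:R <= `|x n.+1| by have := (nxtP (L n)).2; rewrite sizeL.
have [c Cc' cl] := weak_cluster Cc (fun n => (svalP (L n)).1).
have [N _ NP] := nbhs_infty_ger (`|c| + 2).
have [n [Nn /= hn]] := cl _ (nbhs_weak (nf (x N.+1)) c ltr01) N.+1.
have := (svalP (L n)).2 _ (xL _ _ Nn); move: hn; rewrite -/(x n).
have := (nfP (x N.+1)).1 c; have := xbig N.
have /= := NP N.+1 (leqnSn N); rewrite ltr_norml; lra.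
Qed.

Lemma weak_cvg_norm_le (R : realType) (X : normedModType R) (y : nat -> X)
    (x : X) (M : R) : weak_cvg y x ->
  (exists N, forall n, (N <= n)%N -> `|y n| <= M) -> `|x| <= M.
Proof.
move=> /weak_cvg_dist yx [N NM]; have [g [gle gx]] := norming_functional x.
apply/ler_addgt0Pr => e e0; have [K KP] := yx g e e0.
have := KP _ (leq_maxr N K); have := NM _ (leq_maxl N K).
have := gle (y (maxn N K)); rewrite gx ltr_norml; lra.
Qed.

Lemma weak_cvgB (R : realType) (X : normedModType R) (y z : nat -> X) (u v : X) :
  weak_cvg y u -> weak_cvg z v -> weak_cvg (fun n => y n - z n) (u - v).
Proof.
move=> /weak_cvg_dist yu /weak_cvg_dist zv; apply/weak_cvg_dist => g e e0.
have e2 : 0 < e / 2 by lra.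
have [N NP] := yu g _ e2; have [K KP] := zv g _ e2.
exists (maxn N K) => n; rewrite geq_max => /andP[/NP + /KP].
rewrite !pairingB !ltr_norml; lra.
Qed.

Lemma weak_cvg_cst (R : realType) (X : normedModType R) (x : X) :
  weak_cvg (fun=> x) x.
Proof. by apply/weak_cvg_dist => g e e0; exists 0%N => n _; rewrite subrr normr0. Qed.

Lemma weak_cvg_subseq (R : realType) (X : normedModType R) (y : nat -> X) (x : X)
    (phi : nat -> nat) : {homo phi : m n / (m < n)%N} -> weak_cvg y x ->
  weak_cvg (y \o phi) x.
Proof.
move=> phim /weak_cvg_dist yx; apply/weak_cvg_dist => g e e0.
have [N NP] := yx g e e0; exists N => n Nn; apply: NP.
exact: leq_trans Nn (homo_ltn_geq_id phim n).
Qed.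

Lemma weakly_null_scale (R : realType) (X : normedModType R) (y : nat -> X)
    (a : nat -> R) (M : R) : weakly_null y -> (forall n, `|a n| <= M) ->
  weakly_null (fun n => a n *: y n).
Proof.
move=> /weak_cvg_dist y0 aM; apply/weak_cvg_dist => g e e0.
have M0 : 0 <= M := le_trans (normr_ge0 _) (aM 0%N).
have d0 : 0 < e / (M + 1) by rewrite divr_gt0 //; lra.
have [N NP] := y0 g _ d0; exists N => n /NP.
have -> : pairing g 0 = 0 by rewrite -(scale0r 0) pairingZ mul0r.
rewrite !subr0 pairingZ normrM => h.
have {}h : `|pairing g (y n)| * (M + 1) < e by rewrite -ltr_pdivlMr //; lra.
have := aM n; have := normr_ge0 (a n); have := normr_ge0 (pairing g (y n)); nra.
Qed.

Lemma weak_cvgZ (R : realType) (X : normedModType R) (y : nat -> X) (x : X)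
    (a : R) : weak_cvg y x -> weak_cvg (fun n => a *: y n) (a *: x).
Proof.
move=> yx; have yx0 := weak_cvgB yx (@weak_cvg_cst R X x).
rewrite subrr in yx0.
have h := weakly_null_scale (a := fun=> a) yx0 (fun=> lexx _).
have := weak_cvgB h (@weak_cvg_cst R X (- (a *: x))).
rewrite sub0r opprK; congr weak_cvg; apply/funext => n.
by rewrite /= scalerBr subrK.
Qed.

(** * A crease in the unit sphere *)

Lemma limn_esup_ub (R : realType) (u : nat -> \bar R) (c : \bar R) :
  (forall n, u n <= c)%E -> (limn_esup u <= c)%E.
Proof.
move=> uc; rewrite /limn_esup /limf_esup; apply: ge_ereal_inf.
exists (ereal_sup (range u)); first by exists setT => //; exact: filterT.
by apply: ge_ereal_sup => _ [n _ <-].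
Qed.

Lemma limn_einf_lb (R : realType) (u : nat -> \bar R) (c : \bar R) :
  (forall n, c <= u n)%E -> (c <= limn_einf u)%E.
Proof.
move=> uc; rewrite /limn_einf leeNr; apply: limn_esup_ub => n.
by rewrite leeN2.
Qed.

Lemma b1_coef_ge (R : realType) (X : normedModType R) (u : X) (y : nat -> X)
    (r : R) : M_family X y -> (forall n, r <= `|u + y n|) ->
  ((r - `|u|)%:E <= b1_coef 1 u)%E.
Proof.
move=> My ry; apply: (@le_trans _ _
  (limn_einf (fun n => `|u + 1 *: y n|%:E) - `|u|%:E)%E); last first.
  by apply: ereal_sup_ubound; exists y.
rewrite EFinB leeB //; apply: limn_einf_lb => n.
by rewrite scale1r lee_fin.
Qed.

Lemma d_coef_le (R : realType) (X : normedModType R) (u : X) (y : nat -> X)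
    (r : R) : weakly_null y -> (forall n, `|y n| = 1) ->
  (forall n, `|u + y n| <= r) -> (d_coef 1 u <= (r - `|u|)%:E)%E.
Proof.
move=> y0 y1 ry; apply: (@le_trans _ _
  (limn_esup (fun n => `|u + 1 *: y n|%:E) - `|u|%:E)%E).
  by apply: ereal_inf_lbound; exists y.
rewrite EFinB leeB //; apply: limn_esup_ub => n.
by rewrite scale1r lee_fin.
Qed.

(** Replacing the coefficient [t] of [y] by the smaller [s] loses at most
    [t - s], because [|y| <= 1]. *)
Lemma normD_ge (R : realType) (X : normedModType R) (u y : X) (s t r : R) :
  0 < s -> s <= t -> `|y| <= 1 -> r <= `|s *: u + t *: y| ->
  (r - (t - s)) / s <= `|u + y|.
Proof.
move=> s0 st y1 h; rewrite ler_pdivrMr //.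
have -> : `|u + y| * s = `|s *: (u + y)| by rewrite normrZ gtr0_norm // mulrC.
have := ler_normD (s *: (u + y)) ((t - s) *: y).
rewrite [`|(t - s) *: y|]normrZ (ger0_norm (_ : 0 <= t - s)); last lra.
rewrite scalerDr -addrA -scalerDl addrC [s + _]addrC subrK addrC.
have := normr_ge0 y; nra.
Qed.

(** As [|w| >= a], the vector [u + w / |w|] is the convex combination of [u] and
    [(a u + w) / a] with weights [1 - a / |w|] and [a / |w|]. *)
Lemma normD_normalize_le (R : realType) (X : normedModType R) (u w : X)
    (a r : R) : `|u| = 1 -> 0 < a -> a <= `|w| -> `|a *: u + w| <= a + r ->
  0 <= r -> `|u + `|w|^-1 *: w| <= 1 + r / a.
Proof.
move=> u1 a0 aw h r0; have w0 : 0 < `|w| by lra.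
have -> : u + `|w|^-1 *: w = `|w|^-1 *: ((`|w| - a) *: u + (a *: u + w)).
  rewrite addrA -scalerDl subrK scalerDr scalerA mulVf ?gt_eqF // scale1r //.
rewrite normrZ gtr0_norm ?invr_gt0 // mulrC ler_pdivrMr //.
have := ler_normD ((`|w| - a) *: u) (a *: u + w).
rewrite [`|(_ - _) *: u|]normrZ u1 ger0_norm; last lra.
have : r <= r / a * `|w| by rewrite mulrAC ler_pdivlMr // ler_wpM2l.
lra.
Qed.

(** With [u = v / |v|], the weakly null sequence [z - v] points in directions
    along which the norm grows as fast as possible from [u], and the weakly null
    sequence [z - v - x] in directions along which it does not grow.  The first
    holds since [|z|] is almost [1] while [|v|] and [|z - v|] are at most about
    [1/5] and [4/5]; the second since [|v + (z - v - x)| = |z - x|] is at most about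
    [1/5], whereas [|z - v - x| >= |x| - |z - v|] is at least about [1/5]. *)
Lemma crease_direction (R : realType) (X : normedModType R) (x z : nat -> X) (v : X)
    (h : R) : 0 < h -> h <= 1 / 20 -> weakly_null x -> weak_cvg z v ->
  (forall n, 1 - h <= `|x n|) -> (forall n, 1 - h <= `|z n|) ->
  (forall n, `|z n - x n| <= 1 / 5 + h) ->
  (forall n m, `|z n - z m| <= 4 / 5 + h) ->
  exists u : X, [/\ `|u| = 1, ((1 - 20 * h)%:E <= b1_coef 1 u)%E &
    (d_coef 1 u <= (70 * h)%:E)%E].
Proof.
move=> h0 h20 x0 zv x1 z1 zx zz.
have vle : `|v| <= 1 / 5 + h.
  have := weak_cvg_norm_le (weak_cvgB zv x0); rewrite subr0; apply.
  by exists 0%N.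
have zvle n : `|z n - v| <= 4 / 5 + h.
  have znv := weak_cvgB (@weak_cvg_cst R X (z n)) zv.
  by apply: (weak_cvg_norm_le znv); exists 0%N => m _; exact: zz.
have vge : 1 / 5 - 2 * h <= `|v|.
  have := ler_normD (z 0%N - v) v; rewrite subrK; have := zvle 0%N; have := z1 0%N; lra.
have v0 : 0 < `|v| by lra.
pose u := `|v|^-1 *: v.
have u1 : `|u| = 1 by rewrite normrZ gtr0_norm ?invr_gt0 // mulVf ?gt_eqF.
have vu : v = `|v| *: u by rewrite /u scalerA divff ?gt_eqF // scale1r.
have near_v (s e : R) : `|s - `|v| | <= e -> `|s *: u - v| <= e.
  by move=> se; rewrite {1}vu -scalerBl normrZ u1 mulr1.
have wn : weakly_null (fun n => z n - v).
  by have := weak_cvgB zv (@weak_cvg_cst R X v); rewrite subrr.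
have t0 : 0 < 4 / 5 + h by lra.
exists u; split => //.
- pose y n := (4 / 5 + h)^-1 *: (z n - v).
  have yz n : (4 / 5 + h) *: y n = z n - v.
    by rewrite scalerA divff ?gt_eqF // scale1r.
  have y1 n : `|y n| <= 1.
    rewrite normrZ gtr0_norm ?invr_gt0 // mulrC ler_pdivrMr // mul1r; exact: zvle.
  have My : M_family X y.
    split => //; first exact:
      (weakly_null_scale (a := fun=> (4 / 5 + h)^-1) wn (fun=> lexx _)).
    apply: limn_esup_ub => n; apply: limn_esup_ub => m.
    rewrite lee_fin -scalerBr opprB addrA subrK normrZ gtr0_norm ?invr_gt0 //.
    by rewrite mulrC ler_pdivrMr // mul1r; exact: zz.
  apply: le_trans (b1_coef_ge (r := 2 - 20 * h) My _); first by rewrite u1 lee_fin; lra.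
  move=> n; have := @normD_ge _ _ u (y n) (1 / 5) (4 / 5) (1 - 4 * h).
  have -> : (1 - 4 * h - (4 / 5 - 1 / 5)) / (1 / 5) = 2 - 20 * h by lra.
  apply=> //; try lra.
  have e1 : `|(1 / 5) *: u - v| <= 2 * h by apply: near_v; rewrite ler_norml; lra.
  have e2 : `|h *: y n| <= h.
    rewrite normrZ gtr0_norm //; have := y1 n; have := normr_ge0 (y n); nra.
  have -> : (4 / 5) *: y n = (z n - v) - h *: y n by rewrite -yz -scalerBl addrK.
  have -> : `|(1 / 5) *: u + (z n - v - h *: y n)| =
      `|z n + ((1 / 5) *: u - v) - h *: y n|.
    by rewrite addrA (addrA (z n)) [_ *: u + (_ - _)]addrC [z n - v + _]addrAC.
  have := lerB_normD (z n + ((1 / 5) *: u - v)) (- (h *: y n)).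
  have := lerB_normD (z n) ((1 / 5) *: u - v).
  rewrite normrN; have := z1 n; lra.
- pose w n := (z n - v) - x n.
  have w0 : weakly_null w by have := weak_cvgB wn x0; rewrite subrr.
  have wge n : 1 / 5 - 2 * h <= `|w n|.
    have := lerB_dist (x n) (z n - v); rewrite [`|x n - _|]distrC.
    have := zvle n; have := x1 n; rewrite /w; lra.
  have a0 : 0 < 1 / 5 - 2 * h by lra.
  have wn0 n : 0 < `|w n| by have := wge n; lra.
  apply: le_trans (d_coef_le (y := fun n => `|w n|^-1 *: w n)
    (r := 1 + 7 * h / (1 / 5 - 2 * h)) _ _ _) _.
  + apply: (weakly_null_scale (M := (1 / 5 - 2 * h)^-1)) => // n.
    by rewrite gtr0_norm ?invr_gt0 // lef_pV2 ?posrE.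
  + by move=> n; rewrite normrZ gtr0_norm ?invr_gt0 // mulVf ?gt_eqF.
  + move=> n; apply: normD_normalize_le => //; last by lra.
    have e1 : `|(1 / 5 - 2 * h) *: u - v| <= 3 * h.
      by apply: near_v; rewrite ler_norml; lra.
    have := ler_normD ((1 / 5 - 2 * h) *: u - v) (z n - x n).
    have -> : (1 / 5 - 2 * h) *: u - v + (z n - x n) = (1 / 5 - 2 * h) *: u + w n.
      by rewrite /w -addrA; congr (_ + _); rewrite addrCA addrA.
    have := zx n; lra.
  + rewrite u1 lee_fin addrAC subrr add0r ler_pdivrMr //; nra.
Qed.

(** * Averaged iterates of a Suzuki-type mapping *)

(** With [T] satisfying (C_lambda) the relaxation parameter [r] will be lambda
    itself: a point [x] and its average [y] then satisfy
    [r |x - T x| = |x - y|], so that the condition applies to consecutive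
    iterates. *)
Definition averaged (R : realType) (X : normedModType R) (T : X -> X) (r : R)
  (z : X) : X := z + r *: (T z - z).

Section averaged_iteration.
Variables (R : realType) (X : normedModType R) (K : set X) (T : X -> X) (r : R).
Hypotheses (r0 : 0 < r) (r1 : r < 1) (cK : convex_set K).
Hypotheses (TK : forall x, K x -> K (T x)) (CT : condition_C_lambda r K T).

Let av := averaged T r.

Lemma averaged_in x : K x -> K (averaged T r x).
Proof.
by move=> Kx; apply: convex_segment => //; [exact: TK|exact: ltW|exact: ltW].
Qed.

Lemma iter_averaged_in x k : K x -> K (iter k av x).
Proof. by move=> Kx; elim: k => //= k; exact: averaged_in. Qed.

Lemma averaged_step x : `|averaged T r x - x| = r * `|T x - x|.
Proof. by rewrite /averaged addrC addKr normrZ gtr0_norm. Qed.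

Lemma averaged_image x : K x -> `|T (averaged T r x) - T x| <= r * `|T x - x|.
Proof.
move=> Kx; rewrite distrC -averaged_step [leRHS]distrC.
apply: CT => //; first exact: averaged_in.
by rewrite distrC [leRHS]distrC averaged_step.
Qed.

Lemma residual_decr x : K x -> `|T (av x) - av x| <= `|T x - x|.
Proof.
move=> Kx; have := ler_distD (T x) (T (av x)) (av x).
have -> : T x - av x = (1 - r) *: (T x - x).
  by rewrite scalerBl scale1r /av /averaged opprD addrA.
rewrite [X in _ <= _ + X]normrZ (ger0_norm (_ : 0 <= 1 - r));
  last by rewrite subr_ge0 ltW.
have := averaged_image Kx; lra.
Qed.

Lemma residual_iter_decr x k : K x ->
  `|T (iter k av x) - iter k av x| <= `|T x - x|.
Proof.
move=> Kx; elim: k => //= k; apply: le_trans; apply: residual_decr.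
exact: iter_averaged_in.
Qed.

Lemma averaged_iter_image x k : K x ->
  `|T (iter k av x) - T x| <= k%:R * r * `|T x - x|.
Proof.
move=> Kx; elim: k => [|k IH] /=; first by rewrite subrr normr0 !mul0r.
have := ler_distD (T (iter k av x)) (T (av (iter k av x))) (T x).
have := averaged_image (iter_averaged_in k Kx).
have := residual_iter_decr k Kx; rewrite -(ler_pM2l r0) -natr1 !mulrDl mul1r -/av.
lra.
Qed.

(** The inequality of Goebel and Kirk, by induction on [m].  The step applies
    the induction hypothesis to the average of [x] and estimates the distance
    from that average to [T (iter m.+1 av x)] by convexity. *)
Lemma goebel_kirk x m : K x ->
  (1 + m%:R * r) * `|T x - x| <= `|T (iter m av x) - x| +
    ((1 - r)^-1) ^+ m * (`|T x - x| - `|T (iter m av x) - iter m av x|).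
Proof.
have q0 : 0 < 1 - r by rewrite subr_gt0.
elim: m x => [|m IH] x Kx; first by rewrite mul0r addr0 mul1r subrr mulr0 addr0.
have := IH (av x) (averaged_in Kx); rewrite -iterSr; set u := iter m.+1 av x.
set B := (1 - r)^-1 ^+ m => IH1.
have B0 : 1 + m%:R * r <= B.
  rewrite /B; elim: (m) => [|j IHj]; first by rewrite mul0r addr0.
  rewrite exprS ler_pdivlMl // -natr1; have : 0 <= j%:R * r ^+ 2.
    by rewrite mulr_ge0 // exprn_ge0 // ltW.
  have := sqr_ge0 r; have jr : 0 <= j%:R * r by rewrite mulr_ge0 // ltW.
  nra.
have d1 : `|T u - av x| <= (1 - r) * `|T u - x| + r * (m.+1%:R * r * `|T x - x|).
  have -> : T u - av x = (1 - r) *: (T u - x) + r *: (T u - T x).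
    have -> : T u - T x = (T u - x) - (T x - x) by rewrite opprB addrA subrK.
    by rewrite scalerBl scale1r (scalerBr r (T u - x)) addrA subrK /av /averaged
      opprD addrA.
  apply: le_trans (ler_normD _ _) _; rewrite !normrZ !gtr0_norm // lerD2l.
  by rewrite ler_pM2l //; exact: averaged_iter_image.
have d2 := residual_decr Kx.
have P : 0 <= (B - (1 + m%:R * r)) * (`|T x - x| - `|T (av x) - av x|).
  by rewrite mulr_ge0 // subr_ge0.
rewrite -(ler_pM2l q0) exprS mulrDr -/B.
rewrite -(mulrA _ B) mulVKf ?gt_eqF //.
move: IH1 d1 P; rewrite -natr1 -/av.
move: (m%:R) (T u) => k w; lra.
Qed.

(** If the displacement exceeds [d] up to time [L m], then [goebel_kirk] forces
    it to drop by at least [(1 - r) ^ m] during each block of [m] steps, once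
    [m r d > 2 M + 1].  Since the displacement is at most [2 M], this fails as soon
    as the number [L] of blocks exceeds [2 M / (1 - r) ^ m].  Neither [m] nor [L]
    depends on [x]. *)
Lemma averaged_residual_small (M d : R) : (forall x, K x -> `|x| <= M) -> 0 < d ->
  exists N, forall x, K x -> `|T (iter N av x) - iter N av x| <= d.
Proof.
move=> KM d0.
have KM2 x y : K x -> K y -> `|x - y| <= 2 * M.
  move=> Kx Ky; have := ler_normB x y; have := KM _ Kx; have := KM _ Ky; lra.
have dr : 0 < d * r by rewrite mulr_gt0.
have [m] : exists m, (2 * M + 1) / (d * r) < m%:R.
  by exists (Num.bound `|(2 * M + 1) / (d * r)|);
    exact: le_lt_trans (ler_norm _) (archi_boundP (normr_ge0 _)).
rewrite ltr_pdivrMr // => hm.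
pose B := (1 - r)^-1 ^+ m.
have B0 : 0 < B by rewrite exprn_gt0 // invr_gt0 subr_gt0.
have [L] : exists L, 2 * M * B < L%:R.
  by exists (Num.bound `|2 * M * B|);
    exact: le_lt_trans (ler_norm _) (archi_boundP (normr_ge0 _)).
move=> hL; exists (L * m)%N => x Kx; rewrite leNgt; apply/negP => big.
pose a j := `|T (iter j av x) - iter j av x|.
have a_decr i j : (i <= j)%N -> a j <= a i.
  move=> ij; rewrite /a -(subnK ij) iterD.
  exact: residual_iter_decr (iter_averaged_in i Kx).
have drop j : (j <= L)%N -> j%:R <= B * (a 0%N - a (j * m)%N).
  elim: j => [|j IH] jL; first by rewrite mul0n subrr mulr0.
  have := IH (ltnW jL).
  have Kj := iter_averaged_in (j * m) Kx.
  have := goebel_kirk m Kj; rewrite -iterD -mulSn -/B -/(a (j * m)%N) -/(a (j.+1 * m)%N).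
  have := KM2 _ _ (TK (iter_averaged_in (j.+1 * m) Kx)) Kj.
  have : d < a (j * m)%N by apply: lt_le_trans big (a_decr _ _ _);
    rewrite leq_mul2r ltnW ?orbT.
  have : 0 <= m%:R * r by rewrite mulr_ge0 // ltW.
  rewrite -natr1; move: (m%:R) (r) hm => k s hm; nra.
have := drop L (leqnn L); have := KM2 _ _ (TK Kx) Kx; rewrite -/(a 0%N).
move: big; rewrite -/(a (L * m)%N); nra.
Qed.
End averaged_iteration.

(** * Minimal invariant sets *)

Lemma weak_space_hausdorff (R : realType) (X : normedModType R) :
  hausdorff_space (weak_space X).
Proof.
move=> p q clpq; apply: contrapT => /eqP; rewrite -subr_eq0 -normr_gt0 => pq0.
have [g [_ gpq]] := norming_functional ((p : X) - q).
have e0 : 0 < `|(p : X) - q| / 2 by lra.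
have [z [/= zp zq]] := clpq _ _ (nbhs_weak g p e0) (nbhs_weak g q e0).
move: gpq zp zq; rewrite pairingB !ltr_norml; lra.
Qed.

Definition minimal_invariant (R : realType) (X : normedModType R) (T : X -> X)
    (K : set X) : Prop :=
  [/\ K !=set0, convex_set K, closed (K : set (weak_space X)),
    forall x, K x -> K (T x) &
    forall L : set X, L !=set0 -> convex_set L ->
      closed (L : set (weak_space X)) -> (forall x, L x -> L (T x)) ->
      L `<=` K -> K `<=` L].

(** The intersection of a chain of such sets is nonempty by weak compactness of
    [C], a weak cluster point of the filter generated by the chain being in all
    of them. *)
Lemma exists_minimal_invariant (R : realType) (X : normedModType R)
    (T : X -> X) (C : set X) : C !=set0 -> convex_set C -> weakly_compact C ->
  (forall x, C x -> C (T x)) ->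
  exists2 K, K `<=` C & minimal_invariant T K.
Proof.
move=> C0 cC Cc TC.
have clC : closed (C : set (weak_space X)).
  by apply: compact_closed => //; exact: weak_space_hausdorff.
pose P (L : set X) := [/\ L `<=` C, L !=set0, convex_set L,
  closed (L : set (weak_space X)) & forall x, L x -> L (T x)].
have PC : P C by split.
pose Rl (K L : {L | P L}) := `[< sval L `<=` sval K >].
have [|||A Atot|[K [KC K0 cK clK TK]] Kmin] := @Zorn {L | P L} Rl.
- by move=> K; apply/asboolP.
- move=> K L M /asboolP LK /asboolP ML; apply/asboolP; exact: subset_trans LK.
- move=> [K PK] [L PL] /asboolP LK /asboolP KL; apply: eq_exist.
  exact/seteqP.
- have [[K0 AK0]|nA] := pselect (exists K, A K); last first.
    by exists (exist P C PC) => K AK; case: nA; exists K.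
  pose F : set_system (weak_space X) :=
    filter_from A (fun K => (sval K : set (weak_space X))).
  have FF : ProperFilter F.
    apply: filter_from_proper; last by move=> K _; have [] := svalP K.
    apply: filter_from_filter; first by exists K0.
    move=> K L AK AL; have [/asboolP LK|/asboolP KL] := Atot _ _ AK AL.
      by exists L => // x Lx; split=> //; exact: LK.
    by exists K => // x Kx; split=> //; exact: KL.
  have FA K : A K -> F (sval K) by move=> AK; exists K.
  have FC : F C by have [KC0 _ _ _ _] := svalP K0; exists K0.
  have [c [Cc' clc]] := Cc F FF FC.
  have Ac K : A K -> sval K c.
    move=> AK; case: (svalP K) => _ _ _ clK _; apply: clK => U Uc.
    by have := clc _ _ (FA _ AK) Uc.
  have PI : P [set x | forall K, A K -> sval K x].
    split.
    - by move=> x /(_ K0 AK0); case: (svalP K0) => + _ _ _ _; apply.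
    - by exists c.
    - apply/convex_setP => x y t Hx Hy t0 t1 K AK.
      case: (svalP K) => _ _ /convex_setP cK _ _.
      by apply: cK => //; [exact: Hx|exact: Hy].
    - move=> x xcl K AK; case: (svalP K) => _ _ _ clK _; apply: clK => U Ux.
      by have [y [Hy Uy]] := xcl U Ux; exists y; split=> //; exact: Hy.
    - move=> x Hx K AK; case: (svalP K) => _ _ _ _ TK; exact/TK/Hx.
  by exists (exist P _ PI) => K AK; apply/asboolP => x /=; apply.
exists K => //; split=> // L L0 cL clL TL LK x Kx.
have PL : P L by split=> //; exact: subset_trans LK KC.
have KL : Rl (exist P K (And5 KC K0 cK clK TK)) (exist P L PL) by apply/asboolP.
by have [->] := Kmin _ KL.
Qed.

(** The points of [K] whose asymptotic distance from [x], that is the upper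
    limit of [|x n - b|], is at most [r]. *)
Definition asymptotic_ball (R : realType) (X : normedModType R) (K : set X)
    (x : nat -> X) (r : R) : set X :=
  [set b | K b /\ forall e : R, 0 < e -> \forall n \near \oo, `|x n - b| <= r + e].

Lemma asymptotic_ball_convex (R : realType) (X : normedModType R) (K : set X)
  (x : nat -> X) (r : R) : convex_set K -> convex_set (asymptotic_ball K x r).
Proof.
move=> /convex_setP cK; apply/convex_setP => b c t [Kb xb] [Kc xc] t0 t1.
split=> [|e e0]; first exact: cK.
near=> n.
have -> : x n - (t *: b + (1 - t) *: c) = t *: (x n - b) + (1 - t) *: (x n - c).
  rewrite !scalerBr addrACA -scalerDl opprD; congr (_ + _).
  by rewrite addrC subrK scale1r.
apply: le_trans (ler_normD _ _) _; rewrite !normrZ !ger0_norm ?subr_ge0 //.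
have hb : `|x n - b| <= r + e by near: n; exact: xb.
have hc : `|x n - c| <= r + e by near: n; exact: xc.
nra.
Unshelve. all: by end_near. Qed.

Lemma asymptotic_ball_weakly_closed (R : realType) (X : normedModType R)
    (K : set X) (x : nat -> X) (r : R) : convex_set K ->
  closed (K : set (weak_space X)) ->
  closed (asymptotic_ball K x r : set (weak_space X)).
Proof.
move=> cK clK b clb; split=> [|e e0].
  by apply: clK => U /clb[z [[Kz _] Uz]]; exists z.
have e2 : 0 < e / 2 by lra.
have [a [Ka xa] ba] := weak_closure_convex (@asymptotic_ball_convex _ _ _ x r cK) clb e2.
near=> n; have : `|x n - a| <= r + e / 2 by near: n; exact: xa.
have := ler_distD a (x n) b; rewrite [`|a - b|]distrC; lra.
Unshelve. all: by end_near. Qed.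

Definition approx_fixed_seq (R : realType) (X : normedModType R) (K : set X)
    (T : X -> X) (x : nat -> X) : Prop :=
  (forall n, K (x n)) /\
  forall d : R, 0 < d -> \forall n \near \oo, `|x n - T (x n)| <= d.

(** What is used of (C), or of (C_lambda) with continuity, in order to make
    asymptotic balls invariant: seen from a point that is hardly moved, [T x] is
    not much farther away than [x]. *)
Definition asymptotically_nonexpansive_at (R : realType) (X : normedModType R)
    (K : set X) (T : X -> X) : Prop :=
  forall x, K x -> forall e : R, 0 < e -> exists2 d : R, 0 < d &
    forall z, K z -> `|z - T z| <= d -> `|z - T x| <= `|z - x| + e.

Lemma asymptotic_ball_invariant (R : realType) (X : normedModType R)
    (K : set X) (T : X -> X) (x : nat -> X) (r : R) :
  (forall x, K x -> K (T x)) -> asymptotically_nonexpansive_at K T ->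
  approx_fixed_seq K T x ->
  forall b, asymptotic_ball K x r b -> asymptotic_ball K x r (T b).
Proof.
move=> TK AT [Kx Tx] b [Kb xb]; split=> [|e e0]; first exact: TK.
have e2 : 0 < e / 2 by lra.
have [d d0 dP] := AT b Kb _ e2; near=> n.
have hb : `|x n - b| <= r + e / 2 by near: n; exact: xb.
have /(dP _ (Kx n)) : `|x n - T (x n)| <= d by near: n; exact: Tx.
lra.
Unshelve. all: by end_near. Qed.

(** The number [rho] is the least asymptotic radius of [b0] with respect to
    approximate fixed point sequences.  By minimality of [K], a nonempty
    asymptotic ball of such a sequence is all of [K]; so [b0] can be replaced by
    any other point [b], and up to a small error the infimum [rho] bounds from
    below the distance to [b] of the points that are hardly moved.  It is
    attained by a diagonal choice.  If [rho] vanished, the sequence attaining it would converge to both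
    [b0] and [T b0]. *)
Lemma goebel_karlovitz (R : realType) (X : normedModType R) (K : set X)
    (T : X -> X) (M : R) : minimal_invariant T K -> (forall x, K x -> `|x| <= M) ->
  asymptotically_nonexpansive_at K T ->
  (forall d : R, 0 < d -> exists2 z, K z & `|z - T z| <= d) ->
  (forall x, K x -> T x <> x) ->
  exists (rho : R) (x : nat -> X), [/\ 0 < rho, approx_fixed_seq K T x,
    forall b, K b -> asymptotic_ball K x rho b &
    forall b, K b -> forall e : R, 0 < e -> exists2 d : R, 0 < d &
      forall z, K z -> `|z - T z| <= d -> rho - e <= `|z - b|].
Proof.
move=> [[b0 Kb0] cK clK TK Kmin] KM AT afp nofix.
have whole x r b c : approx_fixed_seq K T x -> asymptotic_ball K x r b -> K c ->
    asymptotic_ball K x r c.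
  move=> Tx xb; apply: Kmin; first by exists b.
  - exact: asymptotic_ball_convex.
  - exact: asymptotic_ball_weakly_closed.
  - exact: asymptotic_ball_invariant.
  - by move=> y [].
(* An approximate fixed point sequence with a prescribed property, which may
   depend on the tolerance. *)
have afs (Q : R -> X -> Prop) :
    (forall d : R, 0 < d -> exists z, [/\ K z, `|z - T z| <= d & Q d z]) ->
    exists2 x, approx_fixed_seq K T x & forall n, Q n.+1%:R^-1 (x n).
  move=> H; have inv0 k : 0 < k.+1%:R^-1 :> R by rewrite invr_gt0.
  have [x xP] := choice (fun k => H _ (inv0 k)).
  exists x => [|n]; last by case: (xP n).
  split=> [n|d d0]; first by case: (xP n).
  near=> n; have [_ h _] := xP n; apply: le_trans h _; apply: ltW.
  by near: n; exact: (near_infty_natSinv_lt (PosNum d0)).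
pose S := [set r : R | exists x, approx_fixed_seq K T x /\ asymptotic_ball K x r b0].
have S0 : S !=set0.
  have [|x xT _] := afs (fun _ _ => True).
    by move=> d /afp[z Kz zd]; exists z.
  exists (2 * M), x; split=> //; split=> // e e0; near=> n.
  have [Kx _] := xT; have := ler_normB (x n) b0; have := KM _ (Kx n).
  have := KM _ Kb0; lra.
have Slb : lbound S 0.
  move=> r [x [[Kx Tx] [_ xr]]]; apply/ler_addgt0Pr => e e0.
  have [N _ NP] := xr e e0; have := NP N (leqnn N); exact: le_trans.
have Sinf : has_inf S by split => //; exists 0.
pose rho := inf S.
have lower b : K b -> forall e : R, 0 < e -> exists2 d : R, 0 < d &
    forall z, K z -> `|z - T z| <= d -> rho - e <= `|z - b|.
  move=> Kb e e0; apply: contrapT => nd.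
  have [d d0|x xT xb] := afs (fun _ z => `|z - b| <= rho - e).
    apply: contrapT => nz; apply: nd; exists d => // z Kz zd.
    by rewrite leNgt; apply/negP => zb; apply: nz; exists z; split=> //; exact: ltW.
  have Sr : S (rho - e).
    exists x; split=> //; apply: (whole _ _ b) => //; split=> // a a0.
    by near=> n; have := xb n; lra.
  by have := ge_inf Sinf.2 Sr; rewrite -/rho; lra.
have [x xT xb] : exists2 x, approx_fixed_seq K T x & asymptotic_ball K x rho b0.
  have [d d0|x xT xb] := afs (fun d z => `|z - b0| <= rho + d).
    have d2 : 0 < d / 2 by lra.
    have [r [y [[Ky Ty] [_ yr]]] rd] := inf_adherent d2 Sinf.
    have [N _ NP] := filterI (Ty _ d0) (yr _ d2); have [hT hr] := NP N (leqnn N).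
    by exists (y N); split=> //; rewrite /rho; lra.
  exists x => //; split=> // e e0; near=> n; have := xb n.
  have : n.+1%:R^-1 < e by near: n; exact: (near_infty_natSinv_lt (PosNum e0)).
  move: (n.+1%:R^-1) => k; lra.
have upper b : K b -> asymptotic_ball K x rho b by exact: whole xT xb.
exists rho, x; split=> //; rewrite lt_neqAle andbC; apply/andP; split.
  by apply: lb_le_inf.
apply/eqP => rho0; apply: (nofix b0) => //; apply/eqP; rewrite -subr_eq0 -normr_le0.
apply/ler_addgt0Pr => e e0; rewrite add0r; have e2 : 0 < e / 2 by lra.
have [_ /(_ _ e2) h0] := upper b0 Kb0; have [_ /(_ _ e2) h1] := upper _ (TK _ Kb0).
have [N _ NP] := filterI h0 h1; have [] := NP N (leqnn N); rewrite -rho0 /=.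
have := ler_distD (x N) (T b0) b0; rewrite [`|T b0 - x N|]distrC; lra.
Unshelve. all: by end_near. Qed.

(** * Iterates between an approximate fixed point sequence and its weak limit *)

Lemma sparse_subseq (U : nat -> Prop) (P : nat -> nat -> Prop) :
  (\forall j \near \oo, U j) -> (forall i, \forall j \near \oo, P i j) ->
  exists phi : nat -> nat, [/\ {homo phi : m n / (m < n)%N},
    forall i, U (phi i) & forall i j, (i < j)%N -> P (phi i) (phi j)].
Proof.
move=> [n0 _ Un0] HP.
have [g gP] := choice (fun i => let: ex_intro2 N _ NP := HP i in
  ex_intro (fun N => forall j, (N <= j)%N -> P i j) N NP).
pose G k := (\max_(i < k.+1) g i)%N.
have gG i k : (i <= k)%N -> (g i <= G k)%N.
  by move=> ik; apply: (@leq_bigmax_cond _ _ (fun i : 'I_k.+1 => g i)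
    (Ordinal (ik : (i < k.+1)%N))).
pose phi := fix phi n := if n is m.+1 then maxn (phi m).+1 (G (phi m)) else n0.
have phim : {homo phi : m n / (m < n)%N}.
  by apply: homo_ltn; [exact: ltn_trans|move=> k /=; rewrite leq_max leqnn].
exists phi; split=> // [i|i [//|j]].
  by apply: Un0 => /=; elim: i => //= i IH; rewrite leq_max (leqW IH).
rewrite ltnS => ij; apply: gP; rewrite /= leq_max gG ?orbT //.
by move: ij; rewrite leq_eqVlt => /predU1P[->//|/phim/ltnW].
Qed.

(** The estimates hold for the starting points [x n + (p - x n) / 5], and each
    step of the averaged iteration preserves them, except that the first bound
    grows by [tau].
    For this one needs the inequalities of (C_lambda) for the pairs
    [(x n, z n)] and [(z m, z n)].

    If the condition fails for [(x n, z n)], then [z n] almost coincides with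
    [x n].  This can happen for one [n] only, because for two of them
    [|z m - z n|] would be about [rho], which is more than [4/5 rho].

    For the second pair, the displacement of [z m] is at most about [2/5 rho]
    and [|z m - z n|] is at least about [rho - 2/5 rho].  So the weight [1/5] could be
    any number below [1/4]. *)
Lemma interpolating_iterates (R : realType) (X : normedModType R) (K : set X)
    (T : X -> X) (r : R) (x : nat -> X) (p : X) (rho tau : R) (N : nat) :
  0 < r -> r < 1 -> convex_set K -> (forall y, K y -> K (T y)) ->
  condition_C_lambda r K T -> (forall n, K (x n)) -> K p -> 0 < tau ->
  20 * N.+2%:R * tau <= rho -> (forall n, `|x n - T (x n)| <= tau) ->
  (forall n, `|x n - p| <= rho + tau) ->
  (forall m n, m != n -> rho - tau <= `|x m - x n| <= rho + tau) ->
  forall k, (k <= N)%N -> exists n0, forall m n, (n0 <= m)%N -> (n0 <= n)%N ->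
    let z n := iter k (averaged T r) (x n + (1 / 5) *: (p - x n)) in
    `|z n - x n| <= rho / 5 + k.+1%:R * tau /\
    `|z m - z n| <= 4 / 5 * (rho + tau).
Proof.
move=> r0 r1 cK TK CT Kx Kp tau0 htau xT xp xx.
have rho0 : 0 < rho.
  by apply: lt_le_trans htau; rewrite mulr_gt0 // mulr_gt0 // ltr0n.
pose y n := x n + (1 / 5) *: (p - x n).
have Ky n : K (y n) by apply: convex_segment => //; lra.
elim=> [|k IH] kN.
  exists 0%N => m n _ _ /=; split.
    rewrite addrC addKr normrZ distrC ger0_norm; last lra.
    have := xp n; lra.
  have -> : x m + (1 / 5) *: (p - x m) - (x n + (1 / 5) *: (p - x n)) =
      (4 / 5) *: (x m - x n).
    have -> : (4 / 5 : R) = 1 - 1 / 5 by lra.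
    rewrite [in RHS]scalerBl scale1r opprD addrACA -scalerBr; congr (_ + _).
    by rewrite -scalerN; congr (_ *: _); rewrite !opprB addrC addrA subrK.
  rewrite normrZ gtr0_norm; last lra.
  have [->|mn] := eqVneq m n; first by rewrite subrr normr0; lra.
  have := xx _ _ mn; lra.
have [n0 n0P] := IH (ltnW kN).
set z := fun n => iter k (averaged T r) (y n) in n0P *.
have Kz n : K (z n) by exact: iter_averaged_in.
have kb : (4 * k.+1%:R + 2) * tau <= rho / 5.
  have : k.+2%:R <= N.+2%:R :> R by rewrite ler_nat !ltnS ltnW.
  rewrite -(natr1 k.+1); move: (k.+1%:R) (N.+2%:R) htau => a b; nra.
have k1 : 1 <= k.+1%:R :> R by rewrite ler1n.
have zx n : (n0 <= n)%N -> `|z n - x n| <= rho / 5 + k.+1%:R * tau.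
  by move=> h; case: (n0P n n h h).
pose bad n := `|x n - z n| < r * `|x n - T (x n)|.
(* Both points being close to the corresponding [x] is excluded by
   [4/5 (rho + tau) + 2 tau < rho - tau]. *)
have one_bad m n : (n0 <= m)%N -> (n0 <= n)%N -> m != n -> bad m -> bad n -> False.
  move=> hm hn mn; rewrite /bad => bm bn.
  have [_ hz] := n0P m n hm hn; have /andP[hx _] := xx _ _ mn.
  have := ler_distD (z m) (x m) (x n); have := ler_distD (z n) (z m) (x n).
  rewrite [`|z n - x n|]distrC; have := xT m; have := xT n; nra.
have [n1 n01 good] : exists2 n1, (n0 <= n1)%N & forall n, (n1 <= n)%N -> ~ bad n.
  have [[b [b0 bb]]|nb] := pselect (exists b, (n0 <= b)%N /\ bad b); last first.
    by exists n0 => // n hn bn; apply: nb; exists n.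
  exists b.+1; first exact: leqW.
  move=> n hn bn; apply: (one_bad b n) => //; first exact: leq_trans b0 (ltnW hn).
  by rewrite neq_ltn hn.
have Tz n : (n1 <= n)%N -> `|T (z n) - x n| <= `|z n - x n| + tau.
  move=> hn; have := ler_distD (T (x n)) (T (z n)) (x n).
  have : `|T (x n) - T (z n)| <= `|x n - z n|.
    by apply: CT => //; rewrite leNgt; apply/negP; exact: good.
  rewrite [`|T (x n) - T (z n)|]distrC [`|x n - z n|]distrC [`|T (x n) - x n|]distrC.
  have := xT n; lra.
have avE u v : averaged T r u - v = (1 - r) *: (u - v) + r *: (T u - v).
  have -> : T u - v = (T u - u) + (u - v) by rewrite addrA subrK.
  by rewrite (scalerDr r) addrCA -scalerDl subrK scale1r /averaged addrAC addrC.
exists n1 => m n hm hn; split=> /=; rewrite -/(z n) -?/(z m).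
  rewrite avE; apply: le_trans (ler_normD _ _) _; rewrite !normrZ !gtr0_norm ?subr_gt0 //.
  have := Tz n hn; have := zx n (leq_trans n01 hn); rewrite -(natr1 k.+1).
  move: (k.+1%:R) => a; nra.
have [->|mn] := eqVneq m n; first by rewrite subrr normr0; lra.
have hm0 := leq_trans n01 hm; have hn0 := leq_trans n01 hn.
have [_ zz] := n0P m n hm0 hn0.
have Tzz : `|T (z m) - T (z n)| <= `|z m - z n|.
  apply: CT => //; have := zx m hm0; have := zx n hn0; have := Tz m hm.
  have /andP[hx _] := xx _ _ mn.
  have := ler_distD (z m) (x m) (x n); have := ler_distD (z n) (z m) (x n).
  have := ler_distD (x m) (z m) (T (z m)).
  rewrite [`|x m - T (z m)|]distrC [`|x m - z m|]distrC.
  have := normr_ge0 (z m - T (z m)); move: kb; move: (k.+1%:R) => a; nra.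
rewrite -/(z m) /averaged opprD addrACA -scalerBr.
have -> : z m - z n + r *: (T (z m) - z m - (T (z n) - z n)) =
    (1 - r) *: (z m - z n) + r *: (T (z m) - T (z n)).
  rewrite scalerBl scale1r -[RHS]addrA; congr (_ + _); rewrite -scalerN -scalerDr.
  congr (_ *: _).
  by rewrite !opprB [RHS]addrC addrACA [RHS]addrACA [- T (z n) - z m]addrC.
apply: le_trans (ler_normD _ _) _; rewrite !normrZ !gtr0_norm ?subr_gt0 //.
nra.
Qed.

(** * From mappings without fixed points to creases *)

(** Suzuki's argument.  Since [|T z - T (T z)| <= |z - T z|], one of
    [|z - T z| <= 2 |z - x|] and [|T z - T (T z)| <= 2 |T z - x|] holds, and the
    corresponding instance of (C) gives [|z - T x| <= |z - x| + 3 |z - T z|]. *)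
Lemma suzuki_asymptotically_nonexpansive (R : realType) (X : normedModType R)
    (C : set X) (T : X -> X) : (forall x, C x -> C (T x)) -> condition_C C T ->
  asymptotically_nonexpansive_at C T.
Proof.
move=> TC CT x Cx e e0; exists (e / 3) => [|z Cz ze]; first by lra.
have h1 : `|T z - T (T z)| <= `|z - T z|.
  apply: CT => //; first exact: TC.
  have := normr_ge0 (z - T z); lra.
have [c1|c1] := leP (2^-1 * `|z - T z|) `|z - x|.
  have := CT _ _ Cz Cx c1; have := ler_distD (T z) z (T x); lra.
have c2 : 2^-1 * `|T z - T (T z)| <= `|T z - x|.
  have := ler_distD x z (T z); rewrite [`|x - T z|]distrC; lra.
have := CT _ _ (TC _ Cz) Cx c2.
have := ler_distD (T z) z (T x); have := ler_distD (T (T z)) (T z) (T x).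
have := ler_distD z (T z) x; rewrite [`|T z - z|]distrC; lra.
Qed.

(** (C_lambda) applies to [z] and [x] unless [|z - x| < r |z - T z|].  In that case
    [z] is close to [x] and to [T z], and [T z] is close to [T x] by continuity,
    which is impossible when [z] is hardly moved, since [T x] differs from [x]. *)
Lemma continuous_asymptotically_nonexpansive (R : realType) (X : normedModType R)
    (C : set X) (T : X -> X) (r : R) : 0 < r -> r < 1 ->
  condition_C_lambda r C T -> {within C, continuous T} ->
  (forall x, C x -> T x <> x) -> asymptotically_nonexpansive_at C T.
Proof.
move=> r0 r1 CT cT nofix x Cx e e0.
have Tx0 : 0 < `|T x - x| by rewrite normr_gt0 subr_eq0; apply/eqP; exact: nofix.
have g0 : 0 < `|T x - x| / 3 by lra.
have [s s0 sP] : exists2 s : R, 0 < s & forall z, C z -> `|z - x| < s ->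
    `|T z - T x| < `|T x - x| / 3.
  have /subspace_continuousP/(_ x Cx)/cvgrPdist_lt/(_ _ g0) := cT.
  move=> /nbhs_normP[s /= s0 sP]; exists s => // z Cz zx.
  by rewrite distrC; apply: sP => //=; rewrite distrC.
exists (Num.min e (Num.min s (`|T x - x| / 3))).
  by rewrite !lt_min e0 s0 g0.
move=> z Cz; rewrite !le_min => /and3P[ze zs zg].
have [c|c] := leP (r * `|z - T z|) `|z - x|.
  have := CT _ _ Cz Cx c; have := ler_distD (T z) z (T x); lra.
exfalso; have zx : `|z - x| < s by have := normr_ge0 (z - T z); nra.
have := sP z Cz zx; have := ler_distD (T z) (T x) x; have := ler_distD z (T z) x.
rewrite [`|T z - z|]distrC [`|T x - T z|]distrC; have := normr_ge0 (z - T z).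
nra.
Qed.

(** The order of the choices matters: [h] determines the admissible displacement
    [d] of the final points, [d] determines the number [N] of iterations, and [N]
    determines the precision [tau] with which the [x n] have to be mutually
    equidistant and almost fixed. *)
Lemma no_fixed_point_crease (R : realType) (X : normedModType R) (C : set X)
    (T : X -> X) (r h : R) :
  C !=set0 -> convex_set C -> weakly_compact C -> (forall x, C x -> C (T x)) ->
  0 < r -> r < 1 -> condition_C_lambda r C T ->
  asymptotically_nonexpansive_at C T -> (forall x, C x -> T x <> x) ->
  0 < h -> h <= 1 / 20 ->
  exists u : X, [/\ `|u| = 1, ((1 - 20 * h)%:E <= b1_coef 1 u)%E &
    (d_coef 1 u <= (70 * h)%:E)%E].
Proof.
move=> C0 cC Cc TC r0 r1 CT AT nofix h0 h20.
have [K KC Kmin] := exists_minimal_invariant C0 cC Cc TC.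
have [Kn0 cK clK TK _] := Kmin.
have Kc : weakly_compact K := subclosed_compact clK Cc KC.
have [M KM] := weakly_compact_bounded Kc cK.
have CTK : condition_C_lambda r K T by move=> x y /KC Cx /KC Cy; exact: CT.
have small d : 0 < d -> exists N, forall x, K x ->
    `|T (iter N (averaged T r) x) - iter N (averaged T r) x| <= d.
  by move=> d0; exact: (averaged_residual_small r0 r1 cK TK CTK KM d0).
have [rho [x0 [rho0 [Kx0 Tx0] upper lower]]] :
    exists (rho : R) (x : nat -> X), [/\ 0 < rho, approx_fixed_seq K T x,
    forall b, K b -> asymptotic_ball K x rho b &
    forall b, K b -> forall e : R, 0 < e -> exists2 d : R, 0 < d &
      forall z, K z -> `|z - T z| <= d -> rho - e <= `|z - b|].
  apply: (goebel_karlovitz Kmin KM).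
  - move=> x /KC Cx e e0; have [d d0 dP] := AT x Cx e e0.
    by exists d => // z /KC; exact: dP.
  - move=> d /small[N NP]; have [x Kx] := Kn0.
    exists (iter N (averaged T r) x); first exact: iter_averaged_in.
    by rewrite distrC; exact: NP.
  - by move=> x /KC; exact: nofix.
have [phi [p [phim Kp wx]]] := eberlein_smulian Kc Kx0.
have hr : 0 < h * rho by rewrite mulr_gt0.
have [d d0 dP] := lower p Kp _ hr.
have [N NP] := small d d0.
(* The errors [N.+1 * tau] accumulated in [N] steps stay below [h * rho]. *)
pose tau := h * rho / (10 * N.+2%:R).
have N2 : 1 <= N.+2%:R :> R by rewrite ler1n.
have tauE : tau * (10 * N.+2%:R) = h * rho.
  by rewrite /tau divfK // mulf_neq0 ?gt_eqF // ltr0n.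
have tau0 : 0 < tau by rewrite divr_gt0 // mulr_gt0 // ltr0n.
have near_dist b : K b -> \forall n \near \oo, rho - tau <= `|x0 (phi n) - b| <= rho + tau.
  move=> Kb; have [e e0 eP] := lower b Kb _ tau0; have [_ ub] := upper b Kb.
  have [n1 _ n1P] := Tx0 e e0; have [n2 _ n2P] := ub _ tau0.
  exists (maxn n1 n2) => // n; rewrite /= geq_max => /andP[h1 h2].
  have hphi := homo_ltn_geq_id phim n.
  by rewrite (eP _ (Kx0 _) (n1P _ (leq_trans h1 hphi))) (n2P _ (leq_trans h2 hphi)).
have start : \forall n \near \oo, `|x0 (phi n) - T (x0 (phi n))| <= tau /\
    rho - tau <= `|x0 (phi n) - p| <= rho + tau.
  apply: filterI (near_dist p Kp); have [n1 _ n1P] := Tx0 tau tau0.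
  by exists n1 => // n hn; apply: n1P; exact: leq_trans hn (homo_ltn_geq_id phim n).
have [psi [psim psiU psiP]] := sparse_subseq start (fun i => near_dist _ (Kx0 (phi i))).
pose x n := x0 (phi (psi n)).
have xx m n : m != n -> rho - tau <= `|x m - x n| <= rho + tau.
  by rewrite neq_ltn => /orP[/psiP|/psiP//]; rewrite distrC.
have xp n : rho - tau <= `|x n - p| <= rho + tau := (psiU n).2.
have tau_small : 20 * N.+2%:R * tau <= rho by nra.
have [n0 n0P] := interpolating_iterates r0 r1 cK TK CTK (fun n => Kx0 (phi (psi n)))
  Kp tau0 tau_small (fun n => (psiU n).1) (fun n => (andP (xp n)).2) xx (leqnn N).
pose y n := x (n0 + n)%N + (1 / 5) *: (p - x (n0 + n)%N).
have Ky n : K (y n) by apply: convex_segment => //; [exact: Kx0|lra].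
pose z n := iter N (averaged T r) (y n).
have Kz n : K (z n) by exact: iter_averaged_in.
have zp n : rho - h * rho <= `|z n - p|.
  by apply: dP => //; rewrite distrC; exact: NP.
have [chi [v [chim Kv wz]]] := eberlein_smulian Kc Kz.
pose nrm y := rho^-1 *: (y - p).
have nrmB a b : nrm a - nrm b = rho^-1 *: (a - b).
  by rewrite -scalerBr opprB addrA subrK.
have nrm_norm a : `|rho^-1 *: a| = `|a| / rho.
  by rewrite normrZ gtr0_norm ?invr_gt0 // mulrC.
apply: (@crease_direction R X (fun n => nrm (x (n0 + chi n)%N)) (fun n => nrm (z (chi n))) (nrm v) h) => //.
- have := weak_cvgZ (a := rho^-1) (weak_cvgB wx (@weak_cvg_cst R X p)).
  rewrite subrr scaler0 => w0.
  apply: (@weak_cvg_subseq _ _ _ _ (fun n => psi (n0 + chi n)%N) _ w0).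
  by move=> m n mn; apply: psim; rewrite ltn_add2l; exact: chim.
- exact: (weak_cvgZ (a := rho^-1) (weak_cvgB wz (@weak_cvg_cst R X p))).
- move=> n; rewrite nrm_norm ler_pdivlMr //.
  have /andP[h1 _] := xp (n0 + chi n)%N; nra.
- move=> n; rewrite nrm_norm ler_pdivlMr //; have := zp (chi n); lra.
- move=> n; rewrite nrmB nrm_norm ler_pdivrMr //.
  have [h1 _] := n0P _ _ (leq_addr (chi n) n0) (leq_addr (chi n) n0).
  apply: le_trans h1 _; rewrite -(natr1 N.+1) in tauE N2; nra.
- move=> m n; rewrite nrmB nrm_norm ler_pdivrMr //.
  have [_ h1] := n0P _ _ (leq_addr (chi m) n0) (leq_addr (chi n) n0).
  apply: le_trans h1 _; nra.
Qed.

Theorem theorem4p1 (R : realType) (X : completeNormedModType R) (C : set X)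
    (hX : ~ Schur_property X)
    (hC0 : C !=set0) (hCconv : convex_set C) (hCcomp : weakly_compact C)
    (heps : exists eps : R, [/\ 0 < eps, eps < 1 &
       forall x : X, unit_sphere X x ->
         (b1_coef 1 x < (1 - eps)%:E)%E \/ (eps%:E < d_coef 1 x)%E]) :
  (forall T : X -> X, set_fun C C T -> {within C, continuous T} ->
     (exists lambda : R, [/\ 0 < lambda, lambda < 1 &
        condition_C_lambda lambda C T]) ->
     exists x : X, C x /\ T x = x) /\
  (forall T : X -> X, set_fun C C T -> condition_C C T ->
     exists x : X, C x /\ T x = x).
Proof.
have [eps [eps0 eps1 not_crease]] := heps.
have fixed (T : X -> X) (r : R) : set_fun C C T -> 0 < r -> r < 1 ->
    condition_C_lambda r C T ->
    ((forall x, C x -> T x <> x) -> asymptotically_nonexpansive_at C T) ->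
    exists x : X, C x /\ T x = x.
  move=> TC r0 r1 CT AT; apply: contrapT => nofix'.
  have nofix x : C x -> T x <> x by move=> Cx Tx; apply: nofix'; exists x.
  have h0 : 0 < eps / 100 by lra.
  have h20 : eps / 100 <= 1 / 20 by lra.
  have [u [u1 bu du]] := no_fixed_point_crease hC0 hCconv hCcomp TC r0 r1 CT
    (AT nofix) nofix h0 h20.
  have [bu'|du'] := not_crease u u1.
    by have := le_lt_trans bu bu'; rewrite lte_fin; lra.
  by have := lt_le_trans du' du; rewrite lte_fin; lra.
split=> T TC.
  move=> cT [r [r0 r1 CT]]; apply: (fixed T r) => // nofix.
  exact: continuous_asymptotically_nonexpansive r0 r1 CT cT nofix.
move=> CT; apply: (fixed T 2^-1) => //; first by lra.
by move=> _; exact: suzuki_asymptotically_nonexpansive.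
Qed.
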